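(* ($\mathsf{RCA}_0$) Every partial order with countably many initial intervals is scattered.
   Context: Provability in $\mathsf{RCA}_0$. A partial order $(P,\preceq)$ has $P\subseteq\mathbb{N}$. An initial interval of $P$ is $I\subseteq P$ with $x\preceq y\in I\Rightarrow x\in I$. $P$ has countably many initial intervals if there is a sequence $\{I_n:n\in\mathbb{N}\}$ (coded by one set) such that every initial interval of $P$ equals some $I_n$. $P$ is scattered if there is no order embedding ($x\le y\iff f(x)\preceq f(y)$) of $(\mathbb{Q},\le)$ into $P$. *)

(* Defs.v *)
From Stdlib Require Import List.
Import ListNotations.

(** * The language L2 of second order arithmetic

    Two sorts of variables, numbers and sets, each with its own de Bruijn
    indices: [AllNum] binds number index 0 and leaves set indices alone, [AllSet]
    binds set index 0 and leaves number indices alone.  The only set terms are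
    set variables, and equality is primitive for numbers only. *)

Inductive term : Type :=
| Var (n : nat)
| Zero
| One
| Plus (s t : term)
| Times (s t : term).

Inductive form : Type :=
| EqN (s t : term)
| LtN (s t : term)
| Mem (t : term) (X : nat)
| Bot
| Imp (A B : form)
| AllNum (A : form)
| AllSet (A : form).

(* The calculus is classical, so the other connectives are abbreviations. *)
Definition Neg (A : form) : form := Imp A Bot.
Definition And (A B : form) : form := Neg (Imp A (Neg B)).
Definition Or (A B : form) : form := Imp (Neg A) B.
Definition Iff (A B : form) : form := And (Imp A B) (Imp B A).
Definition ExNum (A : form) : form := Neg (AllNum (Neg A)).
Definition ExSet (A : form) : form := Neg (AllSet (Neg A)).

Declare Scope L2term_scope.
Delimit Scope L2term_scope with tm.
Bind Scope L2term_scope with term.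
Declare Scope L2form_scope.
Delimit Scope L2form_scope with fm.
Bind Scope L2form_scope with form.

Notation "# n" := (Var n) (at level 2, format "# n") : L2term_scope.
Notation "0" := Zero : L2term_scope.
Notation "1" := One : L2term_scope.
Notation "s + t" := (Plus s t) : L2term_scope.
Notation "s * t" := (Times s t) : L2term_scope.
Notation "s = t" := (EqN s%tm t%tm) : L2form_scope.
Notation "s < t" := (LtN s%tm t%tm) : L2form_scope.
Notation "t ∈ X" := (Mem t%tm X) (at level 70) : L2form_scope.
Notation "A ⇒ B" := (Imp A B) (at level 99, right associativity, B at level 200)
  : L2form_scope.
Notation "~ A" := (Neg A) : L2form_scope.
Notation "A /\ B" := (And A B) : L2form_scope.
Notation "A \/ B" := (Or A B) : L2form_scope.
Notation "A <-> B" := (Iff A B) : L2form_scope.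

(** * Substitution *)

Definition scons {T : Type} (x : T) (f : nat -> T) (n : nat) : T :=
  match n with O => x | S k => f k end.

Fixpoint tsubst (sigma : nat -> term) (t : term) : term :=
  match t with
  | Var n => sigma n
  | Zero => Zero
  | One => One
  | Plus s t => Plus (tsubst sigma s) (tsubst sigma t)
  | Times s t => Times (tsubst sigma s) (tsubst sigma t)
  end.

Definition lift (k : nat) (t : term) : term :=
  tsubst (fun n => Var (k + n)) t.

Definition up (sigma : nat -> term) : nat -> term :=
  scons (Var 0) (fun n => lift 1 (sigma n)).

Definition upS (rho : nat -> nat) : nat -> nat :=
  scons 0 (fun n => S (rho n)).

(* [sigma] acts on number variables, [rho] renames set variables. *)
Fixpoint subst (sigma : nat -> term) (rho : nat -> nat) (A : form) : form :=
  match A with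
  | EqN s t => EqN (tsubst sigma s) (tsubst sigma t)
  | LtN s t => LtN (tsubst sigma s) (tsubst sigma t)
  | Mem t X => Mem (tsubst sigma t) (rho X)
  | Bot => Bot
  | Imp A B => Imp (subst sigma rho A) (subst sigma rho B)
  | AllNum A => AllNum (subst (up sigma) rho A)
  | AllSet A => AllSet (subst sigma (upS rho) A)
  end.

Definition shiftN (A : form) : form := subst (fun n => Var (S n)) (fun X => X) A.
Definition shiftS (A : form) : form := subst Var S A.
Definition instN (t : term) (A : form) : form := subst (scons t Var) (fun X => X) A.
Definition instS (Y : nat) (A : form) : form := subst Var (scons Y (fun X => X)) A.

(** * Universal closure *)

(* [tfree], [nfree]: one more than the largest free number index, 0 if there is
   none; [sfree]: the same for set indices. *)
Fixpoint tfree (t : term) : nat :=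
  match t with
  | Var n => S n
  | Zero | One => 0
  | Plus s t | Times s t => Nat.max (tfree s) (tfree t)
  end.

Fixpoint nfree (A : form) : nat :=
  match A with
  | EqN s t | LtN s t => Nat.max (tfree s) (tfree t)
  | Mem t _ => tfree t
  | Bot => 0
  | Imp A B => Nat.max (nfree A) (nfree B)
  | AllNum A => Nat.pred (nfree A)
  | AllSet A => nfree A
  end.

Fixpoint sfree (A : form) : nat :=
  match A with
  | EqN _ _ | LtN _ _ | Bot => 0
  | Mem _ X => S X
  | Imp A B => Nat.max (sfree A) (sfree B)
  | AllNum A => sfree A
  | AllSet A => Nat.pred (sfree A)
  end.

Definition closure (A : form) : form :=
  Nat.iter (sfree A) AllSet (Nat.iter (nfree A) AllNum A).

(** * Provability: classical two-sorted natural deduction with equality *)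

(* [T] is meant to be a set of sentences: the axiom rule is available under any
   hypotheses and below the generalization rules. *)
Inductive derives (T : form -> Prop) : list form -> form -> Prop :=
| d_ax G A : T A -> derives T G A
| d_hyp G A : List.In A G -> derives T G A
| d_impI G A B : derives T (A :: G) B -> derives T G (Imp A B)
| d_impE G A B : derives T G (Imp A B) -> derives T G A -> derives T G B
| d_contra G A : derives T (Neg A :: G) Bot -> derives T G A
| d_allNI G A : derives T (map shiftN G) A -> derives T G (AllNum A)
| d_allNE G A t : derives T G (AllNum A) -> derives T G (instN t A)
| d_allSI G A : derives T (map shiftS G) A -> derives T G (AllSet A)
| d_allSE G A Y : derives T G (AllSet A) -> derives T G (instS Y A)
| d_refl G t : derives T G (EqN t t)
| d_eqE G A s t :
    derives T G (EqN s t) -> derives T G (instN s A) -> derives T G (instN t A).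

Definition provable (T : form -> Prop) (A : form) : Prop := derives T [] A.
Notation "T ⊢ A" := (provable T A%fm) (at level 95, no associativity).

(** * The axioms of RCA0 *)

(* In a bounded quantifier the bound must not contain the quantified variable,
   hence [lift 1 t]. *)
Inductive bounded : form -> Prop :=
| b_eq s t : bounded (EqN s t)
| b_lt s t : bounded (LtN s t)
| b_in t X : bounded (Mem t X)
| b_bot : bounded Bot
| b_imp A B : bounded A -> bounded B -> bounded (Imp A B)
| b_all t A : bounded A -> bounded (AllNum (#0 < lift 1 t ⇒ A))
| b_ex t A : bounded A -> bounded (ExNum (#0 < lift 1 t /\ A)).

Inductive Sigma01 : form -> Prop :=
| Sigma01_intro A : bounded A -> Sigma01 (ExNum A).

Inductive Pi01 : form -> Prop :=
| Pi01_intro A : bounded A -> Pi01 (AllNum A).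

Inductive basic_axiom : form -> Prop :=
| ba_succ_ne0 : basic_axiom (~ (#0 + 1 = 0))
| ba_succ_inj : basic_axiom (#0 + 1 = #1 + 1 ⇒ #0 = #1)
| ba_add0 : basic_axiom (#0 + 0 = #0)
| ba_addS : basic_axiom (#0 + (#1 + 1) = (#0 + #1) + 1)
| ba_mul0 : basic_axiom (#0 * 0 = 0)
| ba_mulS : basic_axiom (#0 * (#1 + 1) = (#0 * #1) + #0)
| ba_lt0 : basic_axiom (~ (#0 < 0))
| ba_ltS : basic_axiom (#0 < #1 + 1 <-> (#0 < #1 \/ #0 = #1)).

(* The induction variable is number index 0; all other free variables of [A]
   are parameters. *)
Definition induction_axiom (A : form) : form :=
  (instN 0 A
   /\ AllNum (A ⇒ subst (scons (#0 + 1)%tm (fun n => Var (S n))) (fun X => X) A)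
   ⇒ AllNum A)%fm.

(* [shiftS A]: the new set is not free in [A]. *)
Definition comprehension_axiom (A B : form) : form :=
  (AllNum (A <-> B) ⇒ ExSet (AllNum (#0 ∈ 0 <-> shiftS A)))%fm.

Inductive RCA0 : form -> Prop :=
| RCA0_basic A : basic_axiom A -> RCA0 (closure A)
| RCA0_Sigma01_induction A : Sigma01 A -> RCA0 (closure (induction_axiom A))
| RCA0_Delta01_comprehension A B :
    Sigma01 A -> Pi01 B -> RCA0 (closure (comprehension_axiom A B)).

(** * Coding of pairs, integers and rationals in RCA0 *)

Definition npair (s t : term) : term := ((s + t) * (s + t) + s)%tm.

(* A Coq pair [(s, t)] of terms stands for the integer s - t. *)
Definition zterm : Type := (term * term)%type.
Definition zcode (a : zterm) : term := npair (fst a) (snd a).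
Definition zmul (a b : zterm) : zterm :=
  ((fst a * fst b + snd a * snd b)%tm, (fst a * snd b + snd a * fst b)%tm).
Definition zeq (a b : zterm) : form := (fst a + snd b = snd a + fst b)%fm.
Definition zlt (a b : zterm) : form := (fst a + snd b < snd a + fst b)%fm.
Definition zle (a b : zterm) : form := (zlt a b \/ zeq a b)%fm.

(* An integer is the code (i,j) that is least among the codes of i - j. *)
Definition isZ (t : term) : form :=
  ExNum (ExNum (lift 2 t = zcode (#1, #0)%tm
    /\ AllNum (AllNum (zeq (#1, #0)%tm (#3, #2)%tm
         ⇒ ~ (zcode (#1, #0)%tm < lift 4 t))))).

Definition isZpos (t : term) : form :=
  (isZ t /\ ExNum (ExNum (lift 2 t = zcode (#1, #0)%tm /\ zlt (0, 0)%tm (#1, #0)%tm)))%fm.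

(* Codes (a,b) of fractions, with a an integer and b a positive integer. *)
Definition isFrac (t : term) : form :=
  ExNum (ExNum (lift 2 t = npair #1 #0 /\ isZ #1 /\ isZpos #0)).

(* With s = (a,b) and t = (c,d), the relation [R] between a * d and b * c. *)
Definition frac_rel (R : zterm -> zterm -> form) (s t : term) : form :=
  Nat.iter 8 ExNum
    (let a := (#7, #6)%tm in let b := (#5, #4)%tm in
     let c := (#3, #2)%tm in let d := (#1, #0)%tm in
     lift 8 s = npair (zcode a) (zcode b)
     /\ lift 8 t = npair (zcode c) (zcode d)
     /\ R (zmul a d) (zmul b c))%fm.

Definition qeq : term -> term -> form := frac_rel zeq.
Definition qle : term -> term -> form := frac_rel zle.

(* A rational is a fraction code that is least among the equal fractions. *)
Definition isQ (t : term) : form :=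
  (isFrac t
   /\ AllNum (isFrac #0 /\ qeq #0 (lift 1 t) ⇒ ~ (#0 < lift 1 t)))%fm.

(** * Partial orders *)

(* Set variables: [P] the carrier, [L] the set of pairs (x,y) with x below y. *)
Definition partial_order (P L : nat) : form :=
  (AllNum (#0 ∈ L ⇒ ExNum (ExNum (#2 = npair #1 #0 /\ #1 ∈ P /\ #0 ∈ P)))
   /\ AllNum (#0 ∈ P ⇒ npair #0 #0 ∈ L)
   /\ AllNum (AllNum (npair #1 #0 ∈ L ⇒ npair #0 #1 ∈ L ⇒ #1 = #0))
   /\ AllNum (AllNum (AllNum
        (npair #2 #1 ∈ L ⇒ npair #1 #0 ∈ L ⇒ npair #2 #0 ∈ L))))%fm.

Definition initial_interval (P L I : nat) : form :=
  (AllNum (#0 ∈ I ⇒ #0 ∈ P)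
   /\ AllNum (AllNum (npair #1 #0 ∈ L ⇒ #0 ∈ I ⇒ #1 ∈ I)))%fm.

(* The outer set variable W codes the sequence I_n = {x | (n,x) in W}. *)
Definition countably_many_initial_intervals (P L : nat) : form :=
  ExSet (AllSet (initial_interval (2 + P) (2 + L) 0
    ⇒ ExNum (AllNum (#0 ∈ 0 <-> npair #1 #0 ∈ 1)))).

(* F is (the set of pairs of) a function from Q to P. *)
Definition function_from_Q (F P : nat) : form :=
  (AllNum (#0 ∈ F ⇒ ExNum (ExNum (#2 = npair #1 #0 /\ isQ #1 /\ #0 ∈ P)))
   /\ AllNum (isQ #0 ⇒ ExNum (npair #1 #0 ∈ F))
   /\ AllNum (AllNum (AllNum
        (npair #2 #1 ∈ F ⇒ npair #2 #0 ∈ F ⇒ #1 = #0))))%fm.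

Definition embedding_of_Q (F P L : nat) : form :=
  (function_from_Q F P
   /\ AllNum (AllNum (AllNum (AllNum
        (npair #3 #1 ∈ F ⇒ npair #2 #0 ∈ F
         ⇒ (qle #3 #2 <-> npair #1 #0 ∈ L))))))%fm.

Definition scattered (P L : nat) : form :=
  (~ ExSet (embedding_of_Q 0 (1 + P) (1 + L)))%fm.

(* Main.v *)
From Stdlib Require Import List Arith Lia Cantor Classical ClassicalEpsilon
  FunctionalExtensionality PropExtensionality Setoid Ring.
Require Import Defs.
Import ListNotations.

(** By Henkin's completeness theorem it is enough to argue in an arbitrary structure
    for RCA0.  Let [f] embed the rationals into [P] and let [I_0, I_1, ...] list the
    initial intervals.  Bisect [(0, 1)]: at stage [n] keep the lower half of the current
    interval if [f] maps its midpoint [c] into [I_n], and the upper half otherwise.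
    If [a_n < b_n] are the endpoints obtained, the initial interval
    [I = {x | x <= f a_n for some n}] differs from each [I_n] at [f c].  It is a set by
    Delta^0_1 comprehension, because [x] is in [I] iff [x <= f b_n] for all [n]: given
    [x], the initial interval [{z | not x <= z}] is some [I_n], and stage [n] makes
    either [x <= f a_(n+1)] or not [x <= f b_(n+1)].  Only the recursion that produces
    the endpoints requires work in RCA0; finite histories are coded by products of
    pairwise coprime numbers. *)

(** * Substitution *)

(** The structure may be nonstandard, so Rocq's own induction says nothing about its numbers: each
    induction over them and each set must come from an explicit formula, written in [dform] and
    displayed by [change] or [cbn]. The graph of an auxiliary function becomes a set by one device:
    for a total single-valued relation, some witness gives the value iff no witness gives another
    value, which is a Sigma form and a Pi form. Lacking exponentiation, the bisection carries its
    denominator [e] and doubles it; lacking subtraction, inequalities are cross-multiplied and carry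
    a slack term. Rationals are least codes, awkward to compute with, so the embedding is moved once
    and for all to arbitrary fractions [k / d] of natural numbers, through [img]. The midpoint
    serves for the diagonal argument because it becomes an endpoint of the next interval: the upper
    one, hence outside the cut, if its image is in the listed interval, and the lower one, hence
    inside, otherwise. *)

Lemma tsubst_comp s r t : tsubst s (tsubst r t) = tsubst (fun n => tsubst s (r n)) t.
Proof. induction t; cbn; congruence. Qed.

Lemma tsubst_Var t : tsubst Var t = t.
Proof. induction t; cbn; congruence. Qed.

Lemma up_comp s r : (fun n => tsubst (up s) (up r n)) = up (fun n => tsubst s (r n)).
Proof.
  extensionality n; destruct n as [|n]; cbn; [reflexivity|].
  unfold lift; rewrite !tsubst_comp; reflexivity.
Qed.

Lemma upS_comp (s r : nat -> nat) : (fun n => upS s (upS r n)) = upS (fun n => s (r n)).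
Proof. extensionality n; destruct n as [|n]; reflexivity. Qed.

Lemma subst_comp A : forall s r s' r',
  subst s r (subst s' r' A) = subst (fun n => tsubst s (s' n)) (fun X => r (r' X)) A.
Proof.
  induction A; intros; cbn; rewrite ?tsubst_comp, ?IHA1, ?IHA2, ?IHA, ?up_comp, ?upS_comp;
    reflexivity.
Qed.

Lemma up_Var : up Var = Var.
Proof. extensionality n; destruct n; reflexivity. Qed.

Lemma upS_id : upS (fun X => X) = (fun X => X).
Proof. extensionality n; destruct n; reflexivity. Qed.

Lemma subst_id A : subst Var (fun X => X) A = A.
Proof.
  induction A; cbn; rewrite ?tsubst_Var, ?up_Var, ?upS_id; congruence.
Qed.

Lemma instN_up s r t A : instN t (subst (up s) r A) = subst (scons t s) r A.
Proof.
  unfold instN; rewrite subst_comp; f_equal.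
  extensionality n; destruct n as [|n]; cbn; [reflexivity|].
  unfold lift; rewrite tsubst_comp; apply tsubst_Var.
Qed.

Lemma instS_up s r Y A : instS Y (subst s (upS r) A) = subst s (scons Y r) A.
Proof.
  unfold instS; rewrite subst_comp; f_equal.
  - extensionality n; apply tsubst_Var.
  - extensionality n; destruct n; reflexivity.
Qed.

Lemma subst_instN s r t A : subst s r (instN t A) = instN (tsubst s t) (subst (up s) r A).
Proof.
  rewrite instN_up; unfold instN; rewrite subst_comp; f_equal.
  extensionality n; destruct n; reflexivity.
Qed.

Lemma subst_instS s r Y A : subst s r (instS Y A) = instS (r Y) (subst s (upS r) A).
Proof.
  rewrite instS_up; unfold instS; rewrite subst_comp; f_equal.
  extensionality n; destruct n; reflexivity.
Qed.

Lemma subst_shiftN s r A : subst (up s) r (shiftN A) = shiftN (subst s r A).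
Proof. unfold shiftN; rewrite !subst_comp; reflexivity. Qed.

Lemma subst_shiftS s r A : subst s (upS r) (shiftS A) = shiftS (subst s r A).
Proof.
  unfold shiftS; rewrite !subst_comp; f_equal.
  extensionality n; cbn; symmetry; apply tsubst_Var.
Qed.

Lemma tsubst_free s s' t :
  (forall n, n < tfree t -> s n = s' n) -> tsubst s t = tsubst s' t.
Proof.
  induction t; cbn; intros H; try reflexivity; try (apply H; lia);
    rewrite IHt1, IHt2; trivial; intros; apply H; lia.
Qed.

Lemma subst_free A : forall s s' r r',
  (forall n, n < nfree A -> s n = s' n) -> (forall X, X < sfree A -> r X = r' X) ->
  subst s r A = subst s' r' A.
Proof.
  induction A; cbn; intros g g' r r' Hn Hs.
  1, 2: rewrite (tsubst_free g g' s), (tsubst_free g g' t); trivial; intros; apply Hn; lia.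
  - rewrite (tsubst_free g g' t Hn), (Hs X) by lia; reflexivity.
  - reflexivity.
  - rewrite (IHA1 g g' r r'), (IHA2 g g' r r'); trivial; intros; try apply Hn; try apply Hs; lia.
  - f_equal; apply IHA; trivial.
    intros [|n] H; cbn; [reflexivity|]; rewrite (Hn n); [reflexivity|lia].
  - f_equal; apply IHA; trivial.
    intros [|n] H; cbn; [reflexivity|]; rewrite (Hs n); [reflexivity|lia].
Qed.

Lemma nfree_iter n A : nfree (Nat.iter n AllNum A) = nfree A - n.
Proof. induction n as [|n IH]; simpl; rewrite ?IH; lia. Qed.

Lemma nfree_iterS n A : nfree (Nat.iter n AllSet A) = nfree A.
Proof. induction n as [|n IH]; simpl; lia. Qed.

Lemma sfree_iter n A : sfree (Nat.iter n AllNum A) = sfree A.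
Proof. induction n as [|n IH]; simpl; lia. Qed.

Lemma sfree_iterS n A : sfree (Nat.iter n AllSet A) = sfree A - n.
Proof. induction n as [|n IH]; simpl; rewrite ?IH; lia. Qed.

Lemma subst_closure s r A : subst s r (closure A) = closure A.
Proof.
  rewrite <- (subst_id (closure A)) at 2; apply subst_free; unfold closure; intros n H; exfalso;
    revert H; rewrite ?nfree_iterS, ?nfree_iter, ?sfree_iterS, ?sfree_iter; lia.
Qed.

Lemma RCA0_closed A s r : RCA0 A -> subst s r A = A.
Proof. intros []; apply subst_closure. Qed.

(** * Structural rules *)

Section Derivations.

Context (T : form -> Prop).

Lemma derives_weaken G A : derives T G A -> forall G', incl G G' -> derives T G' A.
Proof.
  induction 1; intros G' HG.
  - now apply d_ax.
  - now apply d_hyp, HG.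
  - apply d_impI, IHderives; intros B' []; cbn; auto.
  - now apply d_impE with A; auto.
  - apply d_contra, IHderives; intros B' []; cbn; auto.
  - now apply d_allNI, IHderives, incl_map.
  - apply d_allNE; auto.
  - now apply d_allSI, IHderives, incl_map.
  - apply d_allSE; auto.
  - apply d_refl.
  - apply d_eqE with s; auto.
Qed.

Context (T_closed : forall A s r, T A -> subst s r A = A).

(** The axiom rule gives an axiom unchanged in every context, so the induction goes through only
    because substitution leaves axioms fixed. *)
Lemma derives_subst G A :
  derives T G A -> forall s r, derives T (map (subst s r) G) (subst s r A).
Proof.
  induction 1; intros s0 r.
  - rewrite T_closed by trivial; now apply d_ax.
  - now apply d_hyp, in_map.
  - apply d_impI, IHderives.
  - apply d_impE with (subst s0 r A); [apply IHderives1|apply IHderives2].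
  - apply d_contra, IHderives.
  - apply d_allNI.
    replace (map shiftN (map (subst s0 r) G)) with (map (subst (up s0) r) (map shiftN G)).
    + apply IHderives.
    + rewrite !map_map; apply map_ext; intros; apply subst_shiftN.
  - rewrite subst_instN; apply d_allNE, IHderives.
  - apply d_allSI.
    replace (map shiftS (map (subst s0 r) G)) with (map (subst s0 (upS r)) (map shiftS G)).
    + apply IHderives.
    + rewrite !map_map; apply map_ext; intros; apply subst_shiftS.
  - rewrite subst_instS; apply d_allSE, IHderives.
  - apply d_refl.
  - rewrite subst_instN; apply d_eqE with (tsubst s0 s); [apply IHderives1|].
    rewrite <- subst_instN; apply IHderives2.
Qed.

(** The renaming sends [Var k] to [Var 0] and every other [Var n] to [Var (S n)]. On the hypotheses,
    where [k] is not free, it acts as [shiftN], and it turns the instance at [k] back into [B]. *)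
Lemma derives_genN G B k :
  (forall A, In A G -> nfree A <= k) -> nfree (AllNum B) <= k ->
  derives T G (instN (Var k) B) -> derives T G (AllNum B).
Proof.
  intros HG HB H; apply d_allNI.
  apply derives_subst with (s := fun n => if Nat.eq_dec n k then Var 0 else Var (S n))
    (r := fun X => X) in H.
  replace (map shiftN G) with
    (map (subst (fun n => if Nat.eq_dec n k then Var 0 else Var (S n)) (fun X => X)) G).
  - replace B with (subst (fun n => if Nat.eq_dec n k then Var 0 else Var (S n))
      (fun X => X) (instN (Var k) B)) at 1; [exact H|].
    rewrite <- (subst_id B) at 2; unfold instN; rewrite subst_comp.
    apply subst_free; trivial.
    cbn in HB; intros [|n] Hn; cbn -[Nat.eq_dec]; destruct Nat.eq_dec; (reflexivity || lia).
  - apply map_ext_in; intros A HA; apply subst_free; trivial.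
    intros n Hn; specialize (HG A HA); destruct Nat.eq_dec; (reflexivity || lia).
Qed.

Lemma derives_genS G B k :
  (forall A, In A G -> sfree A <= k) -> sfree (AllSet B) <= k ->
  derives T G (instS k B) -> derives T G (AllSet B).
Proof.
  intros HG HB H; apply d_allSI.
  apply derives_subst with (s := Var) (r := fun n => if Nat.eq_dec n k then 0 else S n) in H.
  replace (map shiftS G) with
    (map (subst Var (fun n => if Nat.eq_dec n k then 0 else S n)) G).
  - replace B with (subst Var (fun n => if Nat.eq_dec n k then 0 else S n) (instS k B)) at 1;
      [exact H|].
    rewrite <- (subst_id B) at 2; unfold instS; rewrite subst_comp.
    apply subst_free; trivial.
    cbn in HB; intros [|n] Hn; cbn -[Nat.eq_dec]; destruct Nat.eq_dec; (reflexivity || lia).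
  - apply map_ext_in; intros A HA; apply subst_free; trivial.
    intros n Hn; specialize (HG A HA); destruct Nat.eq_dec; (reflexivity || lia).
Qed.

Lemma derives_bot G A : derives T G Bot -> derives T G A.
Proof. intros H; apply d_contra, (derives_weaken _ _ H); intros B; cbn; auto. Qed.

Lemma derives_eq_sym G s t : derives T G (EqN s t) -> derives T G (EqN t s).
Proof.
  intros H.
  assert (E : forall u, instN u (EqN (Var 0) (lift 1 s)) = EqN u s)
    by (intros u; unfold instN, lift; cbn; rewrite tsubst_comp; cbn; now rewrite tsubst_Var).
  rewrite <- E; apply d_eqE with s; trivial; rewrite E; apply d_refl.
Qed.

Lemma derives_rewrite G A s t f :
  derives T G (EqN s t) -> derives T G (subst (scons s f) (fun X => X) A) ->
  derives T G (subst (scons t f) (fun X => X) A).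
Proof.
  intros H; rewrite <- !instN_up; now apply d_eqE.
Qed.

End Derivations.

(** * Countability of the language *)

Fixpoint tcode (t : term) : nat :=
  match t with
  | Var n => to_nat (0, n)
  | Zero => to_nat (1, 0)
  | One => to_nat (2, 0)
  | Plus s t => to_nat (3, to_nat (tcode s, tcode t))
  | Times s t => to_nat (4, to_nat (tcode s, tcode t))
  end.

Fixpoint fcode (A : form) : nat :=
  match A with
  | EqN s t => to_nat (0, to_nat (tcode s, tcode t))
  | LtN s t => to_nat (1, to_nat (tcode s, tcode t))
  | Mem t X => to_nat (2, to_nat (tcode t, X))
  | Bot => to_nat (3, 0)
  | Imp A B => to_nat (4, to_nat (fcode A, fcode B))
  | AllNum A => to_nat (5, fcode A)
  | AllSet A => to_nat (6, fcode A)
  end.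

Lemma to_nat_inj p q : to_nat p = to_nat q -> p = q.
Proof. intros H; rewrite <- (cancel_of_to p), H; apply cancel_of_to. Qed.

Ltac code_inj :=
  repeat match goal with
  | H : to_nat _ = to_nat _ |- _ => apply to_nat_inj in H
  | H : (_, _) = (_, _) |- _ => apply pair_equal_spec in H; destruct H
  end.

Lemma tcode_inj s : forall t, tcode s = tcode t -> s = t.
Proof.
  induction s; intros []; cbn -[to_nat]; intros H; code_inj; try discriminate;
    f_equal; auto.
Qed.

Lemma fcode_inj A : forall B, fcode A = fcode B -> A = B.
Proof.
  induction A; intros []; cbn -[to_nat]; intros H; code_inj; try discriminate;
    f_equal; auto using tcode_inj.
Qed.

(** Only surjectivity matters: every formula gets its turn at some stage. A number that codes no
    formula decodes arbitrarily. *)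
Definition fdecode (n : nat) : form := epsilon (inhabits Bot) (fun A => fcode A = n).

Lemma fdecode_fcode A : fdecode (fcode A) = A.
Proof.
  apply fcode_inj; unfold fdecode.
  apply (epsilon_spec (inhabits Bot) (fun B => fcode B = fcode A)); now exists A.
Qed.

(** * Structures *)

Record structure := {
  num :> Type;
  sets : Type;
  zero : num;
  one : num;
  add : num -> num -> num;
  mul : num -> num -> num;
  lt : num -> num -> Prop;
  mem : num -> sets -> Prop
}.

Arguments zero {_}.
Arguments one {_}.
Arguments add {_}.
Arguments mul {_}.
Arguments lt {_}.
Arguments mem {_}.

Fixpoint teval {M : structure} (e : nat -> M) (t : term) : M :=
  match t with
  | Var n => e n
  | Zero => zero
  | One => one
  | Plus s t => add (teval e s) (teval e t)
  | Times s t => mul (teval e s) (teval e t)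
  end.

Fixpoint sat {M : structure} (e : nat -> M) (v : nat -> sets M) (A : form) : Prop :=
  match A with
  | EqN s t => teval e s = teval e t
  | LtN s t => lt (teval e s) (teval e t)
  | Mem t X => mem (teval e t) (v X)
  | Bot => False
  | Imp A B => sat e v A -> sat e v B
  | AllNum A => forall x, sat (scons x e) v A
  | AllSet A => forall X, sat e (scons X v) A
  end.

(** * Completeness *)

Section Henkin.

Context (T : form -> Prop) (T_closed : forall A s r, T A -> subst s r A = A).
Context (A0 : form) (A0_underivable : ~ derives T [] A0).

(** * The maximal consistent extension with witnesses *)

Definition freshN (G : list form) : nat := fold_right Nat.max 0 (map nfree G).
Definition freshS (G : list form) : nat := fold_right Nat.max 0 (map sfree G).

Lemma fold_max_le f (G : list form) A :
  In A G -> f A <= fold_right Nat.max 0 (map f G).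
Proof. induction G as [|B G IH]; cbn; [tauto|]; intros [->|H]; [|specialize (IH H)]; lia. Qed.

Definition consistent (G : list form) : Prop := ~ derives T G Bot.

(** Henkin witnesses without new constants: a stage is a finite list, so some variable is free
    nowhere in it. Only negated universal formulas need one, existential quantifiers being
    abbreviations. *)
Definition witness (A : form) (G : list form) : list form :=
  match A with
  | AllNum B => [Neg (instN (Var (freshN (Neg A :: G))) B)]
  | AllSet B => [Neg (instS (freshS (Neg A :: G)) B)]
  | _ => []
  end.

Definition extend (A : form) (G : list form) : list form :=
  if excluded_middle_informative (consistent (A :: G)) then A :: G
  else witness A G ++ Neg A :: G.

Fixpoint stage (n : nat) : list form :=
  match n with
  | 0 => [Neg A0]
  | S n => extend (fdecode n) (stage n)
  end.

Lemma extend_incl A G : incl G (extend A G).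
Proof.
  unfold extend; destruct excluded_middle_informative; intros B HB; [cbn; auto|].
  apply in_or_app; cbn; auto.
Qed.

Lemma stage_incl m n : m <= n -> incl (stage m) (stage n).
Proof.
  induction 1; [apply incl_refl|].
  eapply incl_tran; [eassumption|apply extend_incl].
Qed.

Lemma extend_consistent A G : consistent G -> consistent (extend A G).
Proof.
  intros HG; unfold extend; destruct excluded_middle_informative as [H|H]; trivial.
  assert (HN : consistent (Neg A :: G)).
  { intros HN; apply HG, d_impE with A; [|now apply d_contra].
    apply d_impI, NNPP; exact H. }
  (* Only the quantifier cases add a witness. Were it contradictory, the instance at the fresh
     variable would be derivable, hence the universal formula, whose negation is in the list. *)
  destruct A; trivial; intros HB; apply HN.
  - apply d_impE with (AllNum A); [apply d_hyp; cbn; auto|].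
    apply derives_genN with (freshN (Neg (AllNum A) :: G)); trivial.
    + intros; now apply (fold_max_le nfree).
    + unfold freshN; cbn; lia.
    + now apply d_contra.
  - apply d_impE with (AllSet A); [apply d_hyp; cbn; auto|].
    apply derives_genS with (freshS (Neg (AllSet A) :: G)); trivial.
    + intros; now apply (fold_max_le sfree).
    + unfold freshS; cbn; lia.
    + now apply d_contra.
Qed.

Lemma stage_consistent n : consistent (stage n).
Proof.
  induction n as [|n IH]; [|now apply extend_consistent].
  intros H; apply A0_underivable; now apply d_contra.
Qed.

Definition Th (A : form) : Prop := exists n, derives T (stage n) A.

Lemma Th_map A B :
  (forall G, derives T G A -> derives T G B) -> Th A -> Th B.
Proof. intros H [n Hn]; exists n; auto. Qed.

Lemma Th_map2 A B C :
  (forall G, derives T G A -> derives T G B -> derives T G C) -> Th A -> Th B -> Th C.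
Proof.
  intros H [m Hm] [n Hn]; exists (Nat.max m n); apply H.
  - apply (derives_weaken _ _ _ Hm), stage_incl; lia.
  - apply (derives_weaken _ _ _ Hn), stage_incl; lia.
Qed.

Lemma Th_Bot : ~ Th Bot.
Proof. intros [n Hn]; now apply (stage_consistent n). Qed.

Lemma Th_ax A : T A -> Th A.
Proof. exists 0; now apply d_ax. Qed.

Lemma Th_A0 : ~ Th A0.
Proof.
  intros H; apply Th_Bot, (Th_map2 (Neg A0) A0); trivial.
  - intros G; apply d_impE.
  - exists 0; apply d_hyp; cbn; auto.
Qed.

(** [A] is decided when its own code comes up; a rejection brings its witness along, as the truth
    lemma needs for quantifiers. *)
Lemma Th_dec A : Th A \/ (Th (Neg A) /\ incl (witness A (stage (fcode A))) (stage (S (fcode A)))).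
Proof.
  pose (G := stage (S (fcode A))).
  assert (E : G = extend A (stage (fcode A))) by (cbn; now rewrite fdecode_fcode).
  fold G; unfold extend in E; destruct excluded_middle_informative.
  - left; exists (S (fcode A)); fold G; rewrite E; apply d_hyp; cbn; auto.
  - right; split.
    + exists (S (fcode A)); fold G; rewrite E; apply d_hyp, in_or_app; cbn; auto.
    + rewrite E; apply incl_appl, incl_refl.
Qed.

Lemma Th_Imp A B : Th (Imp A B) <-> (Th A -> Th B).
Proof.
  split; [apply Th_map2; intros G; apply d_impE|].
  intros H; destruct (Th_dec A) as [HA|[HA _]].
  - revert HA; intros HA%H; revert HA; apply Th_map; intros G HB.
    apply d_impI, (derives_weaken _ _ _ HB); intros C; cbn; auto.
  - revert HA; apply Th_map; intros G HN; apply d_impI, derives_bot, d_impE with A.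
    + apply (derives_weaken _ _ _ HN); intros C; cbn; auto.
    + apply d_hyp; cbn; auto.
Qed.

Lemma Th_Neg A : Th A -> ~ Th (Neg A).
Proof. intros HA HN; apply Th_Bot; now apply (proj1 (Th_Imp A Bot) HN). Qed.

Lemma Th_AllNum A : Th (AllNum A) <-> forall t, Th (instN t A).
Proof.
  split.
  - intros H t; revert H; apply Th_map; intros G; apply d_allNE.
  - intros H; destruct (Th_dec (AllNum A)) as [|[_ W]]; trivial.
    exfalso; cbn [witness] in W; eapply Th_Neg; [apply H|].
    eexists; apply d_hyp, W; cbn; left; reflexivity.
Qed.

Lemma Th_AllSet A : Th (AllSet A) <-> forall Y, Th (instS Y A).
Proof.
  split.
  - intros H Y; revert H; apply Th_map; intros G; apply d_allSE.
  - intros H; destruct (Th_dec (AllSet A)) as [|[_ W]]; trivial.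
    exfalso; cbn [witness] in W; eapply Th_Neg; [apply H|].
    eexists; apply d_hyp, W; cbn; left; reflexivity.
Qed.

(** * The term model *)

Lemma Th_refl t : Th (EqN t t).
Proof. exists 0; apply d_refl. Qed.

Lemma Th_sym s t : Th (EqN s t) -> Th (EqN t s).
Proof. apply Th_map; intros G; apply derives_eq_sym. Qed.

Lemma Th_rewrite A s t f :
  Th (EqN s t) -> Th (subst (scons s f) (fun X => X) A) ->
  Th (subst (scons t f) (fun X => X) A).
Proof. apply Th_map2; intros G; apply derives_rewrite. Qed.

Lemma Th_trans s t u : Th (EqN s t) -> Th (EqN t u) -> Th (EqN s u).
Proof.
  intros Hst Htu.
  apply (Th_rewrite (EqN (Var 1) (Var 0)) t u (fun _ => s)); trivial.
Qed.

(* Numbers of the term model are the chosen representatives of the classes of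
   provably equal terms, so that its equality is Leibniz equality. *)
Definition rep (t : term) : term := epsilon (inhabits Zero) (fun s => Th (EqN t s)).

Lemma Th_rep t : Th (EqN t (rep t)).
Proof. unfold rep; apply epsilon_spec; exists t; apply Th_refl. Qed.

Lemma rep_eq s t : rep s = rep t <-> Th (EqN s t).
Proof.
  split; intros H.
  - apply Th_trans with (rep s); [apply Th_rep|rewrite H; apply Th_sym, Th_rep].
  - unfold rep; f_equal; extensionality u; apply propositional_extensionality; split;
      [apply Th_trans, Th_sym|apply Th_trans]; trivial.
Qed.

Definition class : Type := {t : term | rep t = t}.

Definition cls (t : term) : class :=
  exist _ (rep t) (proj2 (rep_eq (rep t) t) (Th_sym _ _ (Th_rep t))).

Lemma cls_eq s t : cls s = cls t <-> Th (EqN s t).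
Proof.
  rewrite <- rep_eq; split; intros H.
  - exact (f_equal (@proj1_sig _ _) H).
  - apply eq_sig_hprop; [intros; apply proof_irrelevance|exact H].
Qed.

Lemma cls_proj (x : class) : cls (proj1_sig x) = x.
Proof. apply eq_sig_hprop; [intros; apply proof_irrelevance|exact (proj2_sig x)]. Qed.

Lemma proj_cls t : Th (EqN t (proj1_sig (cls t))).
Proof. apply Th_rep. Qed.

Definition term_model : structure := {|
  num := class;
  sets := nat;
  zero := cls Zero;
  one := cls One;
  add x y := cls (Plus (proj1_sig x) (proj1_sig y));
  mul x y := cls (Times (proj1_sig x) (proj1_sig y));
  lt x y := Th (LtN (proj1_sig x) (proj1_sig y));
  mem x X := Th (Mem (proj1_sig x) X)
|}.

Lemma Th_congr2 (f : term -> term -> term) s s' t t' :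
  (forall s t g, tsubst g (f s t) = f (tsubst g s) (tsubst g t)) ->
  Th (EqN s s') -> Th (EqN t t') -> Th (EqN (f s t) (f s' t')).
Proof.
  intros Hf Hs Ht.
  pose proof (Th_rewrite (EqN (f (Var 1) (Var 2)) (f (Var 0) (Var 2))) s s'
    (fun n => match n with 0 => s | _ => t end) Hs) as H1.
  cbn in H1; rewrite !Hf in H1; cbn in H1.
  pose proof (Th_rewrite (EqN (f (Var 1) (Var 2)) (f (Var 1) (Var 0))) t t'
    (fun n => match n with 0 => s' | _ => t end) Ht) as H2.
  cbn in H2; rewrite !Hf in H2; cbn in H2.
  apply Th_trans with (f s' t); [apply H1|apply H2]; apply Th_refl.
Qed.

Lemma teval_term_model g t :
  teval (M := term_model) (fun n => cls (g n)) t = cls (tsubst g t).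
Proof.
  induction t; cbn; trivial; rewrite IHt1, IHt2; apply cls_eq, Th_sym;
    [apply (Th_congr2 Plus)|apply (Th_congr2 Times)]; trivial using proj_cls.
Qed.

Lemma Th_LtN s t : Th (LtN (proj1_sig (cls s)) (proj1_sig (cls t))) <-> Th (LtN s t).
Proof.
  assert (H : forall a a' b b', Th (EqN a a') -> Th (EqN b b') -> Th (LtN a b) -> Th (LtN a' b')).
  { intros a a' b b' Ha Hb H.
    apply (Th_rewrite (LtN (Var 1) (Var 0)) b b' (fun _ => a')); trivial.
    apply (Th_rewrite (LtN (Var 0) (Var 1)) a a' (fun _ => b)); trivial. }
  split; apply H; trivial using proj_cls; apply Th_sym, proj_cls.
Qed.

Lemma Th_Mem t X : Th (Mem (proj1_sig (cls t)) X) <-> Th (Mem t X).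
Proof.
  split; intros H.
  - apply (Th_rewrite (Mem (Var 0) X) (rep t) t Var); trivial; apply Th_sym, Th_rep.
  - apply (Th_rewrite (Mem (Var 0) X) t (rep t) Var); trivial; apply Th_rep.
Qed.

(** The truth lemma. The sets of the model are the set variables themselves, so a renaming [r] is
    already a set assignment; generality in [g] and [r] carries the induction under quantifiers. *)
Lemma sat_term_model A : forall g r,
  sat (M := term_model) (fun n => cls (g n)) r A <-> Th (subst g r A).
Proof.
  induction A; intros g r; cbn.
  - rewrite !teval_term_model; apply cls_eq.
  - rewrite !teval_term_model; apply Th_LtN.
  - rewrite !teval_term_model; apply Th_Mem.
  - split; [tauto|apply Th_Bot].
  - rewrite Th_Imp, IHA1, IHA2; reflexivity.
  - rewrite Th_AllNum; split.
    + intros H t; rewrite instN_up; apply IHA.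
      replace (fun n => cls (scons t g n)) with (scons (cls t) (fun n => cls (g n))); [apply H|].
      extensionality n; destruct n; reflexivity.
    + intros H x; rewrite <- (cls_proj x).
      replace (scons (cls (proj1_sig x)) (fun n => cls (g n)))
        with (fun n => cls (scons (proj1_sig x) g n)).
      * apply IHA; rewrite <- instN_up; apply H.
      * extensionality n; destruct n; reflexivity.
  - rewrite Th_AllSet; split; intros H Y.
    + rewrite instS_up; apply IHA, H.
    + apply IHA; rewrite <- instS_up; apply H.
Qed.

Lemma sat_term_model_closed A : sat (M := term_model) (fun n => cls (Var n)) (fun X => X) A <-> Th A.
Proof. rewrite sat_term_model, subst_id; reflexivity. Qed.

End Henkin.

Theorem completeness (T : form -> Prop) (A : form) :
  (forall B s r, T B -> subst s r B = B) ->
  (forall (M : structure) (e : nat -> M) (v : nat -> sets M),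
     (forall B, T B -> sat e v B) -> sat e v A) ->
  provable T A.
Proof.
  intros T_closed H; apply NNPP; intros HA.
  apply (Th_A0 T T_closed A HA), sat_term_model_closed; trivial.
  apply H; intros B HB; apply sat_term_model_closed; trivial; now apply Th_ax.
Qed.

(** * Satisfaction *)

Lemma teval_tsubst {M : structure} (e : nat -> M) g t :
  teval e (tsubst g t) = teval (fun n => teval e (g n)) t.
Proof. induction t; cbn; congruence. Qed.

Lemma teval_lift {M : structure} (e : nat -> M) k t :
  teval e (lift k t) = teval (fun n => e (k + n)) t.
Proof. apply teval_tsubst. Qed.

Lemma teval_free {M : structure} (e e' : nat -> M) t :
  (forall n, n < tfree t -> e n = e' n) -> teval e t = teval e' t.
Proof.
  induction t; cbn; intros H; try reflexivity; try (apply H; lia);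
    rewrite IHt1, IHt2; trivial; intros; apply H; lia.
Qed.

Lemma sat_free {M : structure} A : forall (e e' : nat -> M) (v v' : nat -> sets M),
  (forall n, n < nfree A -> e n = e' n) -> (forall X, X < sfree A -> v X = v' X) ->
  sat e v A <-> sat e' v' A.
Proof.
  induction A; cbn; intros e e' v v' Hn Hs.
  1, 2: rewrite (teval_free e e' s), (teval_free e e' t) by (intros; apply Hn; lia); reflexivity.
  - rewrite (teval_free e e' t Hn), (Hs X) by lia; reflexivity.
  - reflexivity.
  - rewrite (IHA1 e e' v v'), (IHA2 e e' v v'); [reflexivity| | | |];
      intros; (apply Hn || apply Hs); lia.
  - assert (H : forall x, sat (scons x e) v A <-> sat (scons x e') v' A).
    { intros x; apply IHA; trivial.
      intros [|n] H; cbn; trivial; apply Hn; lia. }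
    split; intros H' x; apply H, H'.
  - assert (H : forall X, sat e (scons X v) A <-> sat e' (scons X v') A).
    { intros X; apply IHA; trivial.
      intros [|n] H; cbn; trivial; apply Hs; lia. }
    split; intros H' x; apply H, H'.
Qed.

Lemma sat_subst {M : structure} A : forall (e : nat -> M) (v : nat -> sets M) g r,
  sat e v (subst g r A) <-> sat (fun n => teval e (g n)) (fun X => v (r X)) A.
Proof.
  induction A; intros e v g r; cbn; rewrite ?teval_tsubst; try reflexivity.
  - rewrite IHA1, IHA2; reflexivity.
  - assert (H : forall x, sat (scons x e) v (subst (up g) r A) <->
      sat (scons x (fun n => teval e (g n))) (fun X => v (r X)) A).
    { intros x; rewrite IHA; apply sat_free; trivial.
      intros [|n] _; cbn; trivial; apply teval_lift. }
    split; intros H' x; apply H, H'.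
  - assert (H : forall X, sat e (scons X v) (subst g (upS r) A) <->
      sat (fun n => teval e (g n)) (scons X (fun X => v (r X))) A).
    { intros X; rewrite IHA; apply sat_free; trivial.
      intros [|n] _; reflexivity. }
    split; intros H' x; apply H, H'.
Qed.

Lemma sat_iterN {M : structure} n A : forall (e e' : nat -> M) v,
  sat e v (Nat.iter n AllNum A) -> (forall k, e' (n + k) = e k) -> sat e' v A.
Proof.
  revert A; induction n as [|n IH]; cbn; intros A e e' v H He.
  - revert H; apply sat_free; auto.
  - specialize (H (e' n)); eapply IH; [exact H|].
    intros [|k]; cbn; [now rewrite Nat.add_0_r|].
    rewrite <- He; f_equal; lia.
Qed.

Lemma sat_iterS {M : structure} n A : forall (e : nat -> M) v v',
  sat e v (Nat.iter n AllSet A) -> (forall k, v' (n + k) = v k) -> sat e v' A.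
Proof.
  revert A; induction n as [|n IH]; cbn; intros A e v v' H He.
  - revert H; apply sat_free; auto.
  - specialize (H (v' n)); eapply IH; [exact H|].
    intros [|k]; cbn; [now rewrite Nat.add_0_r|].
    rewrite <- He; f_equal; lia.
Qed.

Lemma sat_closure {M : structure} A (e e' : nat -> M) v v' :
  sat e v (closure A) -> sat e' v' A.
Proof.
  intros H; unfold closure in H.
  (* A hybrid assignment: below [sfree A], which is all that [A] sees, it follows [v']; beyond, it
     is the shifted [v] that the outer quantifiers leave in place. *)
  apply sat_iterS with (v' := fun X => if X <? sfree A then v' X else v (X - sfree A)) in H.
  - apply sat_iterN with (e' := fun n => if n <? nfree A then e' n else e (n - nfree A)) in H.
    + revert H; apply sat_free.
      * intros n Hn; apply Nat.ltb_lt in Hn; now rewrite Hn.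
      * intros X HX; apply Nat.ltb_lt in HX; now rewrite HX.
    + intros k; destruct (Nat.ltb_spec (nfree A + k) (nfree A)); [lia|f_equal; lia].
  - intros k; destruct (Nat.ltb_spec (sfree A + k) (sfree A)); [lia|f_equal; lia].
Qed.

Lemma sat_Neg {M : structure} (e : nat -> M) v A : sat e v (Neg A) <-> ~ sat e v A.
Proof. reflexivity. Qed.

Lemma sat_And {M : structure} (e : nat -> M) v A B :
  sat e v (And A B) <-> sat e v A /\ sat e v B.
Proof. cbn; tauto. Qed.

Lemma sat_Or {M : structure} (e : nat -> M) v A B :
  sat e v (Or A B) <-> sat e v A \/ sat e v B.
Proof. cbn; tauto. Qed.

Lemma sat_Iff {M : structure} (e : nat -> M) v A B :
  sat e v (Iff A B) <-> (sat e v A <-> sat e v B).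
Proof. unfold Iff; rewrite sat_And; reflexivity. Qed.

Lemma sat_ExNum {M : structure} (e : nat -> M) v A :
  sat e v (ExNum A) <-> exists x, sat (scons x e) v A.
Proof.
  cbn; split; [|firstorder].
  intros H; apply NNPP; firstorder.
Qed.

Lemma sat_ExSet {M : structure} (e : nat -> M) v A :
  sat e v (ExSet A) <-> exists X, sat e (scons X v) A.
Proof.
  cbn; split; [|firstorder].
  intros H; apply NNPP; firstorder.
Qed.

(** * Bounded formulas *)

Declare Scope M_scope.
Delimit Scope M_scope with M.
Notation "0" := zero : M_scope.
Notation "1" := one : M_scope.
Notation "x + y" := (add x y) : M_scope.
Notation "x * y" := (mul x y) : M_scope.
Notation "x < y" := (lt x y) : M_scope.
Notation "x ∈ X" := (mem x X) : M_scope.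

Definition pr {M : structure} (x y : M) : M := ((x + y) * (x + y) + x)%M.

(* Bounded formulas with the connectives and the pairing function as
   constructors, so that [dsat] computes to the intended statement. *)
Inductive dterm : Type :=
| dVar (n : nat)
| dZero
| dOne
| dAdd (s t : dterm)
| dMul (s t : dterm)
| dPair (s t : dterm).

Inductive dform : Type :=
| dEq (s t : dterm)
| dLt (s t : dterm)
| dMem (t : dterm) (X : nat)
| dNot (a : dform)
| dAnd (a b : dform)
| dOr (a b : dform)
| dImp (a b : dform)
| dAll (t : dterm) (a : dform)
| dEx (t : dterm) (a : dform).

Declare Scope dterm_scope.
Delimit Scope dterm_scope with dt.
Bind Scope dterm_scope with dterm.
Declare Scope dform_scope.
Delimit Scope dform_scope with df.
Bind Scope dform_scope with dform.

Notation "# n" := (dVar n) : dterm_scope.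
Notation "0" := dZero : dterm_scope.
Notation "1" := dOne : dterm_scope.
Notation "s + t" := (dAdd s t) : dterm_scope.
Notation "s * t" := (dMul s t) : dterm_scope.
Notation "⟨ s , t ⟩" := (dPair s t) : dterm_scope.
Notation "s = t" := (dEq s%dt t%dt) : dform_scope.
Notation "s < t" := (dLt s%dt t%dt) : dform_scope.
Notation "t ∈ X" := (dMem t%dt X) : dform_scope.
Notation "~ A" := (dNot A) : dform_scope.
Notation "A /\ B" := (dAnd A B) : dform_scope.
Notation "A \/ B" := (dOr A B) : dform_scope.
Notation "A ⇒ B" := (dImp A B) : dform_scope.
Notation "'all<' t , A" := (dAll t%dt A)
  (at level 200, t at level 60, A at level 200) : dform_scope.
Notation "'ex<' t , A" := (dEx t%dt A)
  (at level 200, t at level 60, A at level 200) : dform_scope.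

Fixpoint deval {M : structure} (e : nat -> M) (t : dterm) : M :=
  match t with
  | dVar n => e n
  | dZero => zero
  | dOne => one
  | dAdd s t => add (deval e s) (deval e t)
  | dMul s t => mul (deval e s) (deval e t)
  | dPair s t => pr (deval e s) (deval e t)
  end.

Fixpoint dsat {M : structure} (e : nat -> M) (v : nat -> sets M) (a : dform) : Prop :=
  match a with
  | dEq s t => deval e s = deval e t
  | dLt s t => lt (deval e s) (deval e t)
  | dMem t X => mem (deval e t) (v X)
  | dNot a => ~ dsat e v a
  | dAnd a b => dsat e v a /\ dsat e v b
  | dOr a b => dsat e v a \/ dsat e v b
  | dImp a b => dsat e v a -> dsat e v b
  | dAll t a => forall x, lt x (deval e t) -> dsat (scons x e) v a
  | dEx t a => exists x, lt x (deval e t) /\ dsat (scons x e) v a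
  end.

Fixpoint term_of (t : dterm) : term :=
  match t with
  | dVar n => Var n
  | dZero => Zero
  | dOne => One
  | dAdd s t => Plus (term_of s) (term_of t)
  | dMul s t => Times (term_of s) (term_of t)
  | dPair s t => npair (term_of s) (term_of t)
  end.

Fixpoint form_of (a : dform) : form :=
  match a with
  | dEq s t => EqN (term_of s) (term_of t)
  | dLt s t => LtN (term_of s) (term_of t)
  | dMem t X => Mem (term_of t) X
  | dNot a => Neg (form_of a)
  | dAnd a b => And (form_of a) (form_of b)
  | dOr a b => Or (form_of a) (form_of b)
  | dImp a b => Imp (form_of a) (form_of b)
  | dAll t a => AllNum (Imp (LtN (Var 0) (lift 1 (term_of t))) (form_of a))
  | dEx t a => ExNum (And (LtN (Var 0) (lift 1 (term_of t))) (form_of a))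
  end.

Lemma bounded_form_of a : bounded (form_of a).
Proof.
  induction a; cbn [form_of];
    try (apply b_all || apply b_ex); unfold And, Or, Neg; repeat (assumption || constructor).
Qed.

Lemma teval_term_of {M : structure} (e : nat -> M) t : teval e (term_of t) = deval e t.
Proof. induction t; cbn; unfold pr; congruence. Qed.

Lemma sat_form_of {M : structure} v a : forall e : nat -> M,
  sat e v (form_of a) <-> dsat e v a.
Proof.
  induction a; intros e; cbn [form_of dsat];
    rewrite ?sat_Neg, ?sat_And, ?sat_Or, ?sat_ExNum; cbn [sat];
    rewrite ?teval_term_of, ?IHa1, ?IHa2, ?IHa; try reflexivity.
  - assert (E : forall x, teval (scons x e) (lift 1 (term_of t)) = deval e t)
      by (intros x; rewrite teval_lift; apply teval_term_of).
    split; intros H x; specialize (H x); cbn in *; rewrite E, IHa in *; trivial.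
  - assert (E : forall x, teval (scons x e) (lift 1 (term_of t)) = deval e t)
      by (intros x; rewrite teval_lift; apply teval_term_of).
    split; intros [x H]; exists x; rewrite sat_And in *; cbn in *; rewrite E, IHa in *; trivial.
Qed.

Definition env {M : structure} (l : list M) (n : nat) : M := nth n l zero.

Fixpoint dlift (t : dterm) : dterm :=
  match t with
  | dVar n => dVar (S n)
  | dZero => dZero
  | dOne => dOne
  | dAdd s t => dAdd (dlift s) (dlift t)
  | dMul s t => dMul (dlift s) (dlift t)
  | dPair s t => dPair (dlift s) (dlift t)
  end.

Section Model.

Context (M : structure) (e0 : nat -> M) (v0 : nat -> sets M).
Context (M_RCA0 : forall A, RCA0 A -> sat e0 v0 A).

Open Scope M_scope.

Lemma basic A e v : basic_axiom A -> sat (M := M) e v A.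
Proof. intros H; apply (sat_closure A e0 _ v0), M_RCA0; now constructor. Qed.

Lemma Sigma_induction a (e : nat -> M) v :
  (exists z, dsat (scons z (scons 0 e)) v a) ->
  (forall x, (exists z, dsat (scons z (scons x e)) v a) ->
     exists z, dsat (scons z (scons (x + 1) e)) v a) ->
  forall x, exists z, dsat (scons z (scons x e)) v a.
Proof.
  intros H0 HS.
  assert (E : forall e, sat e v (ExNum (form_of a)) <-> exists z, dsat (scons z e) v a).
  { intros e'; rewrite sat_ExNum; split; intros [z Hz]; exists z; apply sat_form_of, Hz. }
  pose proof (sat_closure _ e0 e v0 v (M_RCA0 _ (RCA0_Sigma01_induction (ExNum (form_of a))
    (Sigma01_intro _ (bounded_form_of a))))) as H.
  unfold induction_axiom in H; cbn [sat] in H.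
  intros x; rewrite <- E; revert x; apply H, sat_And; split.
  - unfold instN; rewrite sat_subst.
    apply (sat_free _ (scons 0 e) _ v v); [intros [|n] _; reflexivity|trivial|].
    now apply E.
  - intros x; cbn [sat]; rewrite sat_subst, E; intros Hx; specialize (HS x Hx).
    apply E in HS; revert HS; apply sat_free; [intros [|n] _; reflexivity|trivial].
Qed.

Lemma Delta_comprehension a b (e : nat -> M) v :
  (forall x, (exists z, dsat (scons z (scons x e)) v a) <->
     (forall z, dsat (scons z (scons x e)) v b)) ->
  exists X, forall x, x ∈ X <-> exists z, dsat (scons z (scons x e)) v a.
Proof.
  intros Hab.
  assert (E : forall e, sat e v (ExNum (form_of a)) <-> exists z, dsat (scons z e) v a).
  { intros e'; rewrite sat_ExNum; split; intros [z Hz]; exists z; apply sat_form_of, Hz. }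
  pose proof (sat_closure _ e0 e v0 v (M_RCA0 _ (RCA0_Delta01_comprehension
    (ExNum (form_of a)) (AllNum (form_of b))
    (Sigma01_intro _ (bounded_form_of a)) (Pi01_intro _ (bounded_form_of b))))) as H.
  unfold comprehension_axiom in H; cbn [sat] in H; rewrite sat_ExSet in H.
  destruct H as [X HX].
  - intros x; rewrite sat_Iff, E, Hab; cbn [sat].
    split; intros H z; apply sat_form_of, H.
  - exists X; intros x; specialize (HX x); rewrite sat_Iff in HX; cbn [sat] in HX.
    unfold shiftS in HX; rewrite sat_subst in HX; rewrite <- E; exact HX.
Qed.

(* The predicate is evaluated with a dummy 0 at index 0, so in both lemmas the
   distinguished variable is index 1, as in the two schemes above. *)
Lemma bounded_induction a (e : nat -> M) v :
  dsat (scons 0 (scons 0 e)) v a ->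
  (forall x, dsat (scons 0 (scons x e)) v a -> dsat (scons 0 (scons (x + 1) e)) v a) ->
  forall x, dsat (scons 0 (scons x e)) v a.
Proof.
  intros H0 HS.
  (* The conjunct [#0 = 0] pins the witness, so the existential formula says no more than [a]. *)
  assert (H : forall x, exists z, dsat (scons z (scons x e)) v (#0 = 0 /\ a)%df).
  { apply Sigma_induction.
    - exists 0; now split.
    - intros x (z & Hz & H); cbn in Hz; subst z; exists 0; split; [reflexivity|now apply HS]. }
  intros x; destruct (H x) as (z & Hz & Hx); cbn in Hz; now subst z.
Qed.

Lemma bounded_comprehension a (e : nat -> M) v :
  exists X, forall x, x ∈ X <-> dsat (scons 0 (scons x e)) v a.
Proof.
  destruct (Delta_comprehension (#0 = 0 /\ a)%df (#0 = 0 ⇒ a)%df e v) as [X HX].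
  - intros x; split.
    + intros (z & Hz & H) z' Hz'; cbn in Hz, Hz'; now subst z z'.
    + intros H; exists 0; split; [reflexivity|]; now apply (H 0).
  - exists X; intros x; rewrite HX; split.
    + intros (z & Hz & H); cbn in Hz; now subst z.
    + intros H; exists 0; now split.
Qed.

(** * Arithmetic *)

Implicit Types c d e i j k m n p q u w x y z K : M.
Implicit Types X P L F W G : sets M.

Lemma succ_ne0 x : x + 1 <> 0.
Proof. exact (basic _ (env [x]) v0 ba_succ_ne0). Qed.

Lemma succ_inj x y : x + 1 = y + 1 -> x = y.
Proof. exact (basic _ (env [x; y]) v0 ba_succ_inj). Qed.

Lemma add_0_r x : x + 0 = x.
Proof. exact (basic _ (env [x]) v0 ba_add0). Qed.

Lemma add_succ_r x y : x + (y + 1) = (x + y) + 1.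
Proof. exact (basic _ (env [x; y]) v0 ba_addS). Qed.

Lemma mul_0_r x : x * 0 = 0.
Proof. exact (basic _ (env [x]) v0 ba_mul0). Qed.

Lemma mul_succ_r x y : x * (y + 1) = x * y + x.
Proof. exact (basic _ (env [x; y]) v0 ba_mulS). Qed.

Lemma lt_0 x : ~ x < 0.
Proof. exact (basic _ (env [x]) v0 ba_lt0). Qed.

Lemma lt_succ x y : x < y + 1 <-> (x < y \/ x = y).
Proof.
  pose proof (basic _ (env [x; y]) v0 ba_ltS) as H.
  now rewrite sat_Iff, sat_Or in H.
Qed.

Lemma add_assoc x y z : x + (y + z) = (x + y) + z.
Proof.
  (* Index 0 is the dummy, index 1 the induction variable, and the parameters listed in [env] start
     at index 2. *)
  revert z; refine (bounded_induction (#2 + (#3 + #1) = (#2 + #3) + #1)%df (env [x; y]) v0 _ _); cbn.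
  - now rewrite !add_0_r.
  - intros z H; now rewrite !add_succ_r, H.
Qed.

Lemma add_0_l x : 0 + x = x.
Proof.
  revert x; refine (bounded_induction (0 + #1 = #1)%df (env []) v0 _ _); cbn.
  - apply add_0_r.
  - intros z H; now rewrite !add_succ_r, H.
Qed.

Lemma add_comm x y : x + y = y + x.
Proof.
  assert (H1 : forall x, 1 + x = x + 1).
  { refine (bounded_induction (1 + #1 = #1 + 1)%df (env []) v0 _ _); cbn.
    - now rewrite add_0_r, add_0_l.
    - intros z H; now rewrite add_succ_r, H. }
  revert y; refine (bounded_induction (#2 + #1 = #1 + #2)%df (env [x]) v0 _ _); cbn.
  - now rewrite add_0_r, add_0_l.
  - intros y H; now rewrite add_succ_r, <- (add_assoc y), H1, add_succ_r, H.
Qed.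

Lemma mul_add_r x y z : x * (y + z) = x * y + x * z.
Proof.
  revert z; refine (bounded_induction (#2 * (#3 + #1) = #2 * #3 + #2 * #1)%df (env [x; y]) v0 _ _); cbn.
  - now rewrite mul_0_r, !add_0_r.
  - intros z H; now rewrite add_succ_r, !mul_succ_r, H, add_assoc.
Qed.

Lemma mul_0_l x : 0 * x = 0.
Proof.
  revert x; refine (bounded_induction (0 * #1 = 0)%df (env []) v0 _ _); cbn.
  - apply mul_0_r.
  - intros z H; now rewrite mul_succ_r, H, add_0_r.
Qed.

Lemma mul_succ_l x y : (x + 1) * y = x * y + y.
Proof.
  revert y; refine (bounded_induction ((#2 + 1) * #1 = #2 * #1 + #1)%df (env [x]) v0 _ _); cbn.
  - now rewrite !mul_0_r, add_0_r.
  - intros y H; rewrite !mul_succ_r, H, !add_succ_r, <- !add_assoc.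
    f_equal; now rewrite !add_succ_r, (add_comm y).
Qed.

Lemma mul_comm x y : x * y = y * x.
Proof.
  revert y; refine (bounded_induction (#2 * #1 = #1 * #2)%df (env [x]) v0 _ _); cbn.
  - now rewrite mul_0_r, mul_0_l.
  - intros y H; now rewrite mul_succ_r, mul_succ_l, H.
Qed.

Lemma mul_assoc x y z : x * (y * z) = (x * y) * z.
Proof.
  revert z; refine (bounded_induction (#2 * (#3 * #1) = (#2 * #3) * #1)%df (env [x; y]) v0 _ _); cbn.
  - now rewrite !mul_0_r.
  - intros z H; now rewrite !mul_succ_r, mul_add_r, H.
Qed.

Lemma mul_1_l x : 1 * x = x.
Proof.
  rewrite <- (add_0_l 1), mul_succ_l, mul_0_l; apply add_0_l.
Qed.

Lemma M_semiring : semi_ring_theory (zero (s := M)) one add mul eq.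
Proof.
  constructor; trivial using add_0_l, add_comm, add_assoc, mul_1_l, mul_0_l, mul_comm, mul_assoc.
  intros x y z; rewrite !(mul_comm _ z); apply mul_add_r.
Qed.

Add Ring M_ring : M_semiring.

Lemma add_cancel x y z : x + z = y + z -> x = y.
Proof.
  revert z; refine (bounded_induction (#2 + #1 = #3 + #1 ⇒ #2 = #3)%df (env [x; y]) v0 _ _); cbn.
  - now rewrite !add_0_r.
  - intros z H; rewrite !add_succ_r; intros E; now apply H, succ_inj.
Qed.

Lemma zero_or_succ x : x = 0 \/ exists y, x = y + 1.
Proof.
  assert (H : exists y, x = 0 \/ x = y + 1).
  { revert x; refine (Sigma_induction (#1 = 0 \/ #1 = #0 + 1)%df (env []) v0 _ _); cbn.
    - exists 0; now left.
    - intros x _; exists x; now right. }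
  destruct H as [y []]; eauto.
Qed.

Lemma add_ne_self x z : x <> x + z + 1.
Proof.
  intros H; apply (succ_ne0 z), (add_cancel _ _ x); symmetry.
  rewrite add_0_l; rewrite H at 1; ring.
Qed.

Lemma lt_iff x y : x < y <-> exists z, y = x + z + 1.
Proof.
  split.
  (* The hypothesis moves under the quantifier, because the induction formula must be an existential
     quantifier in front of a bounded matrix. *)
  - intros H; assert (H' : exists z, x < y -> y = x + z + 1); [|destruct H' as [z Hz]; eauto].
    clear H; revert y.
    refine (Sigma_induction (#2 < #1 ⇒ #1 = #2 + #0 + 1)%df (env [x]) v0 _ _); cbn.
    + exists 0; intros H; now apply lt_0 in H.
    + intros y [z Hz].
      destruct (classic (x < y)) as [H|H].
      * exists (z + 1); intros _; rewrite (Hz H) at 1; ring.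
      * exists 0; rewrite lt_succ; intros [| ->]; [tauto|ring].
  - intros [z ->]; revert z.
    refine (bounded_induction (#2 < #2 + #1 + 1)%df (env [x]) v0 _ _); cbn.
    + rewrite add_0_r, lt_succ; now right.
    + intros z H; rewrite lt_succ, add_succ_r; now left.
Qed.

Lemma lt_succ_iff x y : x < y + 1 <-> exists z, y = x + z.
Proof.
  rewrite lt_iff; split; intros [z H]; exists z; [now apply succ_inj|now rewrite H].
Qed.

Lemma le_or_lt x y : (exists z, y = x + z) \/ (exists z, x = y + z + 1).
Proof.
  assert (H : exists z, y = x + z \/ x = y + z + 1).
  { revert y; refine (Sigma_induction (#1 = #2 + #0 \/ #2 = #1 + #0 + 1)%df (env [x]) v0 _ _); cbn.
    - destruct (zero_or_succ x) as [->|[z ->]].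
      + exists 0; left; ring.
      + exists z; right; ring.
    - intros y [z [->|Hz]].
      + exists (z + 1); left; ring.
      + destruct (zero_or_succ z) as [->|[w ->]].
        * exists 0; left; rewrite Hz; ring.
        * exists w; right; rewrite Hz; ring. }
  destruct H as [z []]; eauto.
Qed.

Lemma lt_trans x y z : x < y -> y < z -> x < z.
Proof.
  rewrite !lt_iff; intros [a ->] [b ->]; exists (a + b + 1); ring.
Qed.

Lemma mul_eq0 x y : x * y = 0 -> x = 0 \/ y = 0.
Proof.
  destruct (zero_or_succ x) as [|[a ->]], (zero_or_succ y) as [|[b ->]]; auto.
  intros H; exfalso; apply (succ_ne0 (a * b + a + b)); rewrite <- H; ring.
Qed.

Lemma mul_cancel x y z : z <> 0 -> x * z = y * z -> x = y.
Proof.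
  assert (H : forall x w, z <> 0 -> x * z = (x + w + 1) * z -> False).
  { intros a w Hz H; destruct (mul_eq0 (w + 1) z) as [Hw|]; [|now apply (succ_ne0 w)|contradiction].
    apply (add_cancel _ _ (a * z)); rewrite add_0_l; symmetry; rewrite H at 1; ring. }
  intros Hz E; destruct (le_or_lt x y) as [[w ->]|[w ->]].
  - destruct (zero_or_succ w) as [->|[u ->]]; [ring|].
    exfalso; apply (H x u Hz); rewrite E; ring.
  - exfalso; apply (H y w Hz); now rewrite E.
Qed.

(** The square dominates: if [x + y < x' + y'], then [pr x y] is below the square of [x + y + 1],
    hence below [pr x' y']. So equal codes have equal sums, and cancelling the squares gives
    [x = x']. *)
Lemma pr_inj x y x' y' : pr x y = pr x' y' -> x = x' /\ y = y'.
Proof.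
  assert (H : forall x y x' y' w, pr x y = pr x' y' -> x' + y' = x + y + w + 1 -> False).
  { clear x y x' y'; unfold pr; intros x y x' y' w E H; rewrite H in E.
    apply (add_ne_self x (x' + (x + y) * w * (1 + 1) + (x + y) + y + w * w + w + w)).
    apply (add_cancel _ _ ((x + y) * (x + y))).
    rewrite (add_comm x ((x + y) * (x + y))), E at 1; ring. }
  intros E; destruct (le_or_lt (x + y) (x' + y')) as [[w Hw]|[w Hw]].
  - destruct (zero_or_succ w) as [->|[u ->]].
    + rewrite add_0_r in Hw; unfold pr in E; rewrite Hw in E.
      assert (x = x') as ->.
      { apply (add_cancel _ _ ((x + y) * (x + y))); rewrite !(add_comm _ ((x + y) * (x + y))).
        now symmetry. }
      split; trivial; apply (add_cancel _ _ x'); rewrite !(add_comm _ x'); now symmetry.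
    + exfalso; apply (H x y x' y' u E); rewrite Hw; ring.
  - exfalso; apply (H x' y' x y w); [now symmetry|trivial].
Qed.

Lemma pr_fst_le x y : x < pr x y + 1.
Proof. apply lt_succ_iff; exists ((x + y) * (x + y)); unfold pr; ring. Qed.

Lemma pr_snd_le x y : y < pr x y + 1.
Proof.
  apply lt_succ_iff; unfold pr; destruct (zero_or_succ y) as [->|[z ->]].
  - exists (x * x + x); ring.
  - exists (x * x + (1 + 1) * (x * z + x) + z * z + z + x); ring.
Qed.

Lemma least_element X x : x ∈ X -> exists y, y ∈ X /\ forall z, z ∈ X -> ~ z < y.
Proof.
  intros Hx; apply NNPP; intros Hmin.
  assert (H : forall n i, i < n -> ~ i ∈ X).
  { refine (bounded_induction (all< #1, ~ #0 ∈ 0)%df (env []) (fun _ => X) _ _); cbn.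
    - intros i Hi; now apply lt_0 in Hi.
    - intros n IH i; rewrite lt_succ; intros [Hi| ->] HX; [now apply (IH i)|].
      apply Hmin; exists n; split; trivial; intros z Hz Hzn; now apply (IH z). }
  apply (H (x + 1) x); trivial; apply lt_succ; now right.
Qed.


Lemma le_pr_l a x y : a < x + 1 -> a < pr x y + 1.
Proof.
  pose proof (pr_fst_le x y) as H.
  rewrite !lt_succ_iff in *; destruct H as [c Hc]; intros [b Hb].
  exists (b + c); rewrite Hc, Hb; ring.
Qed.

Lemma le_pr_r a x y : a < y + 1 -> a < pr x y + 1.
Proof.
  pose proof (pr_snd_le x y) as H.
  rewrite !lt_succ_iff in *; destruct H as [c Hc]; intros [b Hb].
  exists (b + c); rewrite Hc, Hb; ring.
Qed.

Ltac pr_bound := solve [auto 7 using pr_fst_le, pr_snd_le, le_pr_l, le_pr_r].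

Ltac pr_inj :=
  repeat match goal with
  | H : pr _ _ = pr _ _ |- _ => apply pr_inj in H; destruct H
  end.

(** * Finite sets coded by numbers *)

(** The moduli of Gödel's beta function, with [i] counted from 0. *)
Definition modulus m i : M := (i + 1) * m + 1.

(* The numbers [modulus m i] are pairwise coprime for [i < K] when every positive
   number up to [K] divides [m], so their products code the subsets of [{i | i < K}]. *)
Definition coded K c m i : Prop := i < K /\ exists u, u < c + 1 /\ c = u * modulus m i.

Definition dcoded (K c m i : dterm) : dform :=
  (i < K /\ ex< c + 1, dlift c = #0 * ((dlift i + 1) * dlift m + 1))%df.

(** The divisor is positive, so the quotient is at most [b]; divisibility is thereby a bounded
    formula. *)
Lemma dvd_bounded a b : (exists u, u < b + 1 /\ b = u * (a + 1)) <-> exists u : M, b = u * (a + 1).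
Proof.
  split; intros [u H]; exists u; [tauto|]; split; trivial.
  apply lt_succ_iff; exists (u * a); rewrite H; ring.
Qed.

Lemma dvd_sub a b c d : c + a * d = b * d -> exists u, c = u * d.
Proof.
  intros H; destruct (le_or_lt a b) as [[w ->]|[w ->]].
  - exists w; apply (add_cancel _ _ (a * d)); rewrite H; ring.
  - exists 0; destruct (zero_or_succ c) as [->|[x ->]]; [ring|exfalso].
    apply (add_ne_self (b * d) (x + w * d + d)); rewrite <- H at 1; ring.
Qed.

(** The witness is the factorial of [K]; there is no term for it, so Sigma induction builds it. *)
Lemma common_multiple K : exists m, m <> 0 /\ forall d, d < K -> exists q, m = q * (d + 1).
Proof.
  assert (H : exists m, m <> 0 /\ forall d, d < K -> exists q, q < m + 1 /\ m = q * (d + 1)).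
  { revert K; refine (Sigma_induction
      (~ #0 = 0 /\ all< #1, ex< #1 + 1, #2 = #0 * (#1 + 1))%df (env []) v0 _ _); cbn.
    - exists 1; split; [rewrite <- (add_0_l 1); apply succ_ne0|].
      intros d Hd; now apply lt_0 in Hd.
    - intros K (m & Hm & H); exists (m * (K + 1)); split.
      + intros E; apply mul_eq0 in E; destruct E as [|E]; [tauto|now apply succ_ne0 in E].
      + intros d Hd; apply dvd_bounded; apply lt_succ in Hd; destruct Hd as [Hd| ->].
        * destruct (H d Hd) as (q & _ & Hq); exists (q * (K + 1)); rewrite Hq at 1; ring.
        * now exists m. }
  destruct H as (m & Hm & H); exists m; split; trivial.
  intros d Hd; destruct (H d Hd) as (q & _ & Hq); eauto.
Qed.

(** A Bezout identity. Modulo [modulus m i], the number [(i + 1) * m] is congruent to -1, so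
    [(i + 1) * modulus m k] is congruent to [i - k], which is [d + 1] up to sign. As
    [m = q * (d + 1)], multiplying by [(i + 1) * q] shows that [(i + 1) * (i + 1) * q] inverts
    [modulus m k] up to sign; the two cases are the two signs. *)
Lemma modulus_coprime K m i k c :
  (forall d, d < K -> exists q, m = q * (d + 1)) -> i < K -> k < K -> i <> k ->
  (exists u, c * modulus m k = u * modulus m i) -> exists u, c = u * modulus m i.
Proof.
  intros Hm Hi Hk Hik [u Hu]; unfold modulus in *.
  destruct (le_or_lt i k) as [[w ->]|[d ->]].
  - destruct (zero_or_succ w) as [->|[d ->]]; [exfalso; apply Hik; ring|].
    destruct (Hm d) as [q Hq].
    { apply lt_trans with (i + (d + 1)); trivial; apply lt_iff; exists i; ring. }
    apply dvd_sub with ((i + 1) * (i + d + 1 + 1) * q * c) (c + (i + 1) * (i + 1) * q * u).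
    replace ((c + (i + 1) * (i + 1) * q * u) * ((i + 1) * m + 1)) with
      (c * ((i + 1) * m + 1) + (i + 1) * (i + 1) * q * (u * ((i + 1) * m + 1))) by ring.
    rewrite <- Hu, Hq; ring.
  - destruct (Hm d) as [q Hq].
    { apply lt_trans with (k + d + 1); trivial; apply lt_iff; exists k; ring. }
    apply dvd_sub with ((k + d + 1 + 1) * (k + d + 1 + 1) * q * u)
      (c * (1 + (k + d + 1 + 1) * (k + 1) * q)).
    replace ((k + d + 1 + 1) * (k + d + 1 + 1) * q * u * ((k + d + 1 + 1) * m + 1)) with
      ((k + d + 1 + 1) * (k + d + 1 + 1) * q * (u * ((k + d + 1 + 1) * m + 1))) by ring.
    rewrite <- Hu, Hq; ring.
Qed.

(** The code is the product of the moduli at the [i < k] in [X], built one factor at a time; by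
    coprimality a new factor makes no other modulus a divisor. *)
Lemma finite_set_coded X K : exists c m, forall i, coded K c m i <-> i < K /\ i ∈ X.
Proof.
  destruct (common_multiple K) as (m & Hm & Hdvd).
  assert (H : forall k, exists c, forall i, i < K ->
    (((exists u, u < c + 1 /\ c = u * modulus m i) -> i < k /\ i ∈ X) /\
     (i < k /\ i ∈ X -> exists u, u < c + 1 /\ c = u * modulus m i))).
  { refine (Sigma_induction (all< #2,
      (((ex< #1 + 1, #2 = #0 * ((#1 + 1) * #5 + 1)) ⇒ #0 < #2 /\ #0 ∈ 0) /\
       (#0 < #2 /\ #0 ∈ 0 ⇒ ex< #1 + 1, #2 = #0 * ((#1 + 1) * #5 + 1))))%df
      (env [K; m]) (fun _ => X) _ _); cbn.
    (* The empty product: no modulus divides 1, because [m] is nonzero. *)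
    - exists 1; intros i Hi; split; [|intros [Hi0 _]; now apply lt_0 in Hi0].
      rewrite dvd_bounded; intros [u Hu]; exfalso.
      destruct (zero_or_succ u) as [->|[w ->]].
      + apply (succ_ne0 0); rewrite add_0_l, Hu; ring.
      + destruct (zero_or_succ m) as [|[a ->]]; [tauto|].
        apply (add_ne_self 1 (w * i * a + w * i + w * a + w + i * a + i + a + w)).
        rewrite Hu at 1; ring.
    - intros k (c & Hc); destruct (classic (k < K /\ k ∈ X)) as [[HkK HkX]|Hk].
      + exists (c * modulus m k); intros i Hi; specialize (Hc i Hi).
        rewrite !dvd_bounded in *; rewrite lt_succ.
        destruct (classic (i = k)) as [->|Hik].
        * split; [auto|]; intros _; now exists c.
        * split.
          -- intros H; apply (modulus_coprime K) in H; trivial.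
             apply Hc in H; tauto.
          -- intros [[H|] HX]; [|tauto]; destruct (proj2 Hc (conj H HX)) as [u Hu].
             exists (u * modulus m k); rewrite Hu at 1; unfold modulus; ring.
      + exists c; intros i Hi; specialize (Hc i Hi); rewrite lt_succ.
        split; [tauto|]; intros [[H| ->] HX]; tauto. }
  destruct (H K) as [c Hc]; exists c, m; intros i; unfold coded; split.
  - intros [Hi Hu]; split; trivial; now apply Hc.
  - intros [Hi HX]; split; trivial; now apply Hc.
Qed.

(** * Primitive recursion *)

(** A local condition: each coded pair is the start or follows by [T] from a coded pair one stage
    earlier. An entry at [n] thus vouches for a whole run from stage 0, and since all quantifiers
    stay below [K] the condition is bounded. *)
Definition history T s K c m : Prop :=
  forall p, p < K -> coded K c m p -> p = pr 0 s \/
    exists j, j < K /\ exists u, u < K /\ exists w, w < K /\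
      p = pr (j + 1) w /\ coded K c m (pr j u) /\ pr j (pr u w) ∈ T.

(** The arguments are indices as seen from outside; each offset counts the quantifiers crossed. [T]
    is a set index, which number quantifiers do not shift. *)
Definition dhistory (T s K c m : nat) : dform :=
  (all< #K, (dcoded #(S K) #(S c) #(S m) #0 ⇒ #0 = ⟨0, #(S s)⟩ \/
    ex< #(S K), ex< #(2 + K), ex< #(3 + K),
      (#3 = ⟨#2 + 1, #0⟩ /\ dcoded #(4 + K) #(4 + c) #(4 + m) ⟨#2, #1⟩ /\
       ⟨#2, ⟨#1, #0⟩⟩ ∈ T)))%df.

Lemma coded_snd_lt K c m j w : coded K c m (pr j w) -> w < K.
Proof.
  intros [HK _]; destruct (proj1 (lt_succ _ _) (pr_snd_le j w)) as [Hlt|E].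
  - now apply lt_trans with (pr j w).
  - now rewrite E.
Qed.

(** Induction on the stage [j]; keeping the values below [K] and [K'] makes the induction formula
    bounded. *)
Lemma history_unique T s K c m K' c' m' :
  (forall n u w w', pr n (pr u w) ∈ T -> pr n (pr u w') ∈ T -> w = w') ->
  history T s K c m -> history T s K' c' m' ->
  forall j w w', coded K c m (pr j w) -> coded K' c' m' (pr j w') -> w = w'.
Proof.
  intros T_fun H H'.
  assert (E : forall j w, w < K -> forall w', w' < K' ->
    coded K c m (pr j w) -> coded K' c' m' (pr j w') -> w = w').
  { refine (bounded_induction (all< #2, all< #6,
      (dcoded #4 #5 #6 ⟨#3, #1⟩ ⇒ dcoded #7 #8 #9 ⟨#3, #0⟩ ⇒ #1 = #0))%df
      (env [K; c; m; K'; c'; m']) v0 _ _).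
    - change (forall w, w < K -> forall w', w' < K' ->
        coded K c m (pr 0 w) -> coded K' c' m' (pr 0 w') -> w = w').
      intros w _ w' _ Hw Hw'.
      destruct (H _ (proj1 Hw) Hw) as [E|(j & _ & u & _ & x & _ & E & _)]; pr_inj;
        [|exfalso; eapply succ_ne0; symmetry; eassumption].
      destruct (H' _ (proj1 Hw') Hw') as [E|(j & _ & u & _ & x & _ & E & _)]; pr_inj;
        [|exfalso; eapply succ_ne0; symmetry; eassumption].
      congruence.
    - change (forall j,
        (forall w, w < K -> forall w', w' < K' ->
           coded K c m (pr j w) -> coded K' c' m' (pr j w') -> w = w') ->
        (forall w, w < K -> forall w', w' < K' ->
           coded K c m (pr (j + 1) w) -> coded K' c' m' (pr (j + 1) w') -> w = w')).
      intros j IH w _ w' _ Hw Hw'.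
      destruct (H _ (proj1 Hw) Hw) as [E|(i & _ & u & Hu & x & _ & E & Hi & Hx)]; pr_inj;
        [exfalso; eapply succ_ne0; eassumption|].
      destruct (H' _ (proj1 Hw') Hw') as [E|(i' & _ & u' & Hu' & x' & _ & E & Hi' & Hx')]; pr_inj;
        [exfalso; eapply succ_ne0; eassumption|].
      subst x x'.
      assert (i = j) by (apply succ_inj; congruence).
      assert (i' = j) by (apply succ_inj; congruence).
      subst i i'; rewrite (IH u Hu u' Hu' Hi Hi') in Hx.
      now apply (T_fun _ _ _ _ Hx). }
  intros j w w' Hw Hw'; apply (E j); eauto using coded_snd_lt.
Qed.

(** Puts several witnesses under one bound, since a Sigma formula here has a single unbounded
    quantifier. *)
Lemma bound5 a b c d f : exists z : M, a < z /\ b < z /\ c < z /\ d < z /\ f < z.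
Proof.
  exists (a + b + c + d + f + 1); rewrite !lt_iff.
  split; [exists (b + c + d + f); ring|].
  split; [exists (a + c + d + f); ring|].
  split; [exists (a + b + d + f); ring|].
  split; [exists (a + b + c + f); ring|exists (a + b + c + d); ring].
Qed.

(** The new entry may exceed [K], and a larger bound calls for other moduli; so the old entries are
    made into a set, enlarged, and coded afresh. *)
Lemma history_extend T s K c m n v w :
  history T s K c m -> coded K c m (pr n v) -> pr n (pr v w) ∈ T ->
  exists K' c' m', history T s K' c' m' /\ coded K' c' m' (pr (n + 1) w).
Proof.
  intros H Hv Hw.
  destruct (bounded_comprehension (dcoded #2 #3 #4 #1 \/ #1 = #5)%df
    (env [K; c; m; pr (n + 1) w]) v0) as [X HX].
  change (forall i, i ∈ X <-> coded K c m i \/ i = pr (n + 1) w) in HX.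
  set (K' := K + pr (n + 1) w + 1).
  assert (HK : forall i, coded K c m i -> i < K').
  { intros i [Hi _]; apply lt_trans with K; trivial.
    apply lt_iff; exists (pr (n + 1) w); reflexivity. }
  assert (Hp : pr (n + 1) w < K') by (apply lt_iff; exists K; unfold K'; ring).
  destruct (finite_set_coded X K') as (c' & m' & Hc).
  assert (Hi : forall i, coded K c m i -> coded K' c' m' i).
  { intros i Hi; apply Hc; split; auto; apply HX; auto. }
  exists K', c', m'; split; [|apply Hc; split; trivial; apply HX; auto].
  assert (B : forall p, p < K' -> forall x, x < p + 1 -> x < K').
  { intros p HpK x Hx; apply lt_succ in Hx; destruct Hx as [Hx| ->]; trivial.
    now apply lt_trans with p. }
  intros p HpK Hcp; apply Hc in Hcp; destruct Hcp as [_ Hcp]; apply HX in Hcp.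
  destruct Hcp as [Hcp| ->].
  - destruct (H p (proj1 Hcp) Hcp) as [|(j & Hj & u & Hu & x & Hx & E & Hju & HT)]; [auto|].
    right; exists j; split; [|exists u; split; [|exists x; split; [|auto]]];
      apply lt_trans with K; trivial; apply lt_iff; exists (pr (n + 1) w); reflexivity.
  - right; exists n; split; [|exists v; split; [|exists w; split; [|auto]]].
    + apply (B (pr n v)); [now apply HK|apply pr_fst_le].
    + apply (B (pr n v)); [now apply HK|apply pr_snd_le].
    + apply (B (pr (n + 1) w)); [trivial|apply pr_snd_le].
Qed.

Lemma history_start T s : exists K c m, history T s K c m /\ coded K c m (pr 0 s).
Proof.
  destruct (bounded_comprehension (#1 = #2)%df (env [pr 0 s]) v0) as [X HX].
  change (forall i, i ∈ X <-> i = pr 0 s) in HX.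
  destruct (finite_set_coded X (pr 0 s + 1)) as (c & m & Hc).
  exists (pr 0 s + 1), c, m; split.
  - intros p _ Hp; left; apply HX, Hc, Hp.
  - apply Hc; split; [apply lt_succ; now right|now apply HX].
Qed.

(** [V] is a domain on which the step relation [T] is total; membership in it is carried along as an
    invariant of the values. *)
Lemma recursion T V s :
  (forall n u w w', pr n (pr u w) ∈ T -> pr n (pr u w') ∈ T -> w = w') ->
  s ∈ V -> (forall n v, v ∈ V -> exists w, w ∈ V /\ pr n (pr v w) ∈ T) ->
  exists G, (forall n v w, pr n v ∈ G -> pr n w ∈ G -> v = w) /\ pr 0 s ∈ G /\
    (forall n, exists v, v ∈ V /\ pr n v ∈ G) /\
    (forall n v w, pr n v ∈ G -> pr n (pr v w) ∈ T -> pr (n + 1) w ∈ G).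
Proof.
  intros T_fun Hs T_total.
  pose (sv := fun X : nat => match X with O => T | _ => V end).
  assert (Ex : forall n, exists v K c m, v ∈ V /\ coded K c m (pr n v) /\ history T s K c m).
  { assert (H : forall n, exists z, exists v, v < z /\ exists K, K < z /\ exists c, c < z /\
      exists m, m < z /\ v ∈ V /\ coded K c m (pr n v) /\ history T s K c m).
    { refine (Sigma_induction (ex< #0, ex< #1, ex< #2, ex< #3,
        (#3 ∈ 1 /\ dcoded #2 #1 #0 ⟨#5, #3⟩ /\ dhistory 0 6 2 1 0))%df (env [s]) sv _ _).
      - change (exists z, exists v, v < z /\ exists K, K < z /\ exists c, c < z /\
          exists m, m < z /\ v ∈ V /\ coded K c m (pr 0 v) /\ history T s K c m).
        destruct (history_start T s) as (K & c & m & H & Hc).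
        destruct (bound5 s K c m 0) as (z & ? & ? & ? & ? & _).
        exists z, s; split; trivial; exists K; split; trivial; exists c; split; trivial.
        exists m; auto.
      - change (forall n,
         (exists z, exists v, v < z /\ exists K, K < z /\ exists c, c < z /\
           exists m, m < z /\ v ∈ V /\ coded K c m (pr n v) /\ history T s K c m) ->
          exists z, exists v, v < z /\ exists K, K < z /\ exists c, c < z /\
           exists m, m < z /\ v ∈ V /\ coded K c m (pr (n + 1) v) /\ history T s K c m).
        intros n (_ & v & _ & K & _ & c & _ & m & _ & Hv & Hc & H).
        destruct (T_total n v Hv) as (w & Hw & HT).
        destruct (history_extend T s K c m n v w H Hc HT) as (K' & c' & m' & H' & Hc').
        destruct (bound5 w K' c' m' 0) as (z & ? & ? & ? & ? & _).
        exists z, w; split; trivial; exists K'; split; trivial; exists c'; split; trivial.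
        exists m'; auto. }
    intros n; destruct (H n) as (z & v & _ & K & _ & c & _ & m & _ & Hv); eauto. }
  (* Sigma form: some history has the entry [(n, v)]. Pi form: no history has another value at [n].
     Uniqueness of histories gives one direction, their existence the other. *)
  destruct (Delta_comprehension
    (ex< #1 + 1, ex< #2 + 1, (#3 = ⟨#1, #0⟩ /\ ex< #2, ex< #3, ex< #4,
       (dcoded #2 #1 #0 ⟨#4, #3⟩ /\ dhistory 0 7 2 1 0)))%df
    (ex< #1 + 1, ex< #2 + 1, (#3 = ⟨#1, #0⟩ /\ all< #2, all< #3, all< #4, all< #5,
       (dcoded #2 #1 #0 ⟨#5, #3⟩ /\ dhistory 0 8 2 1 0 ⇒ #3 = #4)))%df
    (env [s]) sv) as [G HG].
  { change (forall x,
      (exists z n, n < x + 1 /\ exists v, v < x + 1 /\ (x = pr n v /\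
        exists K, K < z /\ exists c, c < z /\ exists m, m < z /\
          coded K c m (pr n v) /\ history T s K c m)) <->
      (forall z, exists n, n < x + 1 /\ exists v, v < x + 1 /\ (x = pr n v /\
        forall v', v' < z -> forall K, K < z -> forall c, c < z -> forall m, m < z ->
          coded K c m (pr n v') /\ history T s K c m -> v' = v))).
    intros x; split.
    - intros (z & n & Hn & v & Hv & Hx & K & _ & c & _ & m & _ & Hc & H) z'.
      exists n; split; trivial; exists v; split; trivial; split; trivial.
      intros v' _ K' _ c' _ m' _ [Hc' H'].
      exact (history_unique T s K' c' m' K c m T_fun H' H n v' v Hc' Hc).
    (* At bound 0 the universal part is vacuous: this instance only splits [x] into a pair. The
       bound that matters is chosen once a history is at hand. *)
    - intros H; destruct (H 0) as (n & Hn & v & Hv & -> & _).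
      destruct (Ex n) as (v' & K & c & m & _ & Hc & Hh).
      destruct (bound5 v' K c m 0) as (z & ? & ? & ? & ? & _).
      destruct (H z) as (n' & _ & v'' & _ & E & Huniq); pr_inj; subst n' v''.
      assert (v' = v) by (apply (Huniq v') with K c m; auto); subst v'.
      exists z, n; split; trivial; exists v; split; trivial; split; trivial.
      exists K; split; trivial; exists c; split; trivial; exists m; auto. }
  change (forall x, x ∈ G <->
    exists z n, n < x + 1 /\ exists v, v < x + 1 /\ (x = pr n v /\
        exists K, K < z /\ exists c, c < z /\ exists m, m < z /\
          coded K c m (pr n v) /\ history T s K c m)) in HG.
  assert (HG' : forall n v, pr n v ∈ G <->
    exists K c m, coded K c m (pr n v) /\ history T s K c m).
  { intros n v; rewrite HG; split.
    - intros (z & n' & _ & v' & _ & E & K & _ & c & _ & m & _ & H); pr_inj; subst n' v'.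
      exists K, c, m; trivial.
    - intros (K & c & m & H); destruct (bound5 K c m 0 0) as (z & ? & ? & ? & _).
      exists z, n; split; [apply pr_fst_le|]; exists v; split; [apply pr_snd_le|].
      split; trivial.
      exists K; split; trivial; exists c; split; trivial; exists m; auto. }
  clear HG; exists G.
  assert (G_fun : forall n v w, pr n v ∈ G -> pr n w ∈ G -> v = w).
  { intros n v w; rewrite !HG'; intros (K & c & m & Hc & H) (K' & c' & m' & Hc' & H').
    exact (history_unique T s K c m K' c' m' T_fun H H' n v w Hc Hc'). }
  repeat split; trivial.
  - destruct (history_start T s) as (K & c & m & H & Hc); apply HG'; eauto.
  - intros n; destruct (Ex n) as (v & K & c & m & Hv & Hc & H).
    exists v; split; trivial; apply HG'; eauto.
  - intros n v w Hv HT; apply HG' in Hv; destruct Hv as (K & c & m & Hc & H).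
    destruct (history_extend T s K c m n v w H Hc HT) as (K' & c' & m' & H' & Hc').
    apply HG'; eauto.
Qed.

(** * Rational numbers *)

(** Here and below, unsimplified sums such as [0 + j < 0 + i] are the literal values of the terms in
    the formulas, so that the [sat_] lemmas end by [reflexivity]. *)
Definition semZ x : Prop :=
  exists i j, x = pr i j /\ forall i' j', i' + j = j' + i -> ~ pr i' j' < x.

Definition semZpos x : Prop := semZ x /\ exists i j, x = pr i j /\ 0 + j < 0 + i.

Definition semFrac x : Prop := exists a b, x = pr a b /\ semZ a /\ semZpos b.

Definition semrel (R : M -> M -> Prop) x y : Prop :=
  exists a a' b b' c c' d d',
    x = pr (pr a a') (pr b b') /\ y = pr (pr c c') (pr d d') /\
    R ((a * d + a' * d') + (b * c' + b' * c)) ((a * d' + a' * d) + (b * c + b' * c')).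

Definition semQ x : Prop :=
  semFrac x /\ forall y, semFrac y /\ semrel eq y x -> ~ y < x.

(* [known] goes first: the lemmas on connectives also match unfolded definitions. *)
Ltac sat_simpl known :=
  repeat (known || setoid_rewrite sat_And || setoid_rewrite sat_Or || setoid_rewrite sat_ExNum
    || setoid_rewrite sat_Neg || setoid_rewrite teval_lift || (progress (cbn [sat teval]))).

Lemma sat_isZ (e : nat -> M) v t : sat (M := M) e v (isZ t) <-> semZ (teval e t).
Proof. unfold isZ, zeq, zcode, npair; cbn [fst snd]; sat_simpl fail; reflexivity. Qed.

Lemma sat_isZpos (e : nat -> M) v t : sat (M := M) e v (isZpos t) <-> semZpos (teval e t).
Proof.
  unfold isZpos, zlt, zcode, npair; cbn [fst snd].
  sat_simpl ltac:(rewrite sat_isZ); reflexivity.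
Qed.

Lemma sat_isFrac (e : nat -> M) v t : sat (M := M) e v (isFrac t) <-> semFrac (teval e t).
Proof.
  unfold isFrac, npair.
  sat_simpl ltac:(setoid_rewrite sat_isZpos || setoid_rewrite sat_isZ); reflexivity.
Qed.

Lemma sat_qeq (e : nat -> M) v s t : sat (M := M) e v (qeq s t) <-> semrel eq (teval e s) (teval e t).
Proof.
  unfold qeq, frac_rel, zeq, zmul, zcode, npair; cbn [Nat.iter nat_rect fst snd].
  sat_simpl fail; reflexivity.
Qed.

Lemma sat_qle (e : nat -> M) v s t :
  sat (M := M) e v (qle s t) <-> semrel (fun a b => a < b \/ a = b) (teval e s) (teval e t).
Proof.
  unfold qle, frac_rel, zle, zlt, zeq, zmul, zcode, npair; cbn [Nat.iter nat_rect fst snd].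
  sat_simpl fail; reflexivity.
Qed.

Lemma sat_isQ (e : nat -> M) v t : sat (M := M) e v (isQ t) <-> semQ (teval e t).
Proof.
  unfold isQ.
  sat_simpl ltac:(setoid_rewrite sat_isFrac || setoid_rewrite sat_qeq); reflexivity.
Qed.

(** The fraction [k / d] of natural numbers, each coded as an integer with second component 0. The
    bisection stays in the unit interval, so these fractions suffice. *)
Definition fr k d : M := pr (pr k 0) (pr d 0).

Lemma fr_fst_le k d : k < fr k d + 1.
Proof.
  pose proof (pr_fst_le k 0) as H; pose proof (pr_fst_le (pr k 0) (pr d 0)) as H'.
  apply lt_succ_iff in H, H'; destruct H as [a Ha], H' as [b Hb].
  apply lt_succ_iff; exists (a + b); unfold fr; rewrite Hb, Ha; ring.
Qed.

Lemma fr_snd_le k d : d < fr k d + 1.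
Proof.
  pose proof (pr_fst_le d 0) as H; pose proof (pr_snd_le (pr k 0) (pr d 0)) as H'.
  apply lt_succ_iff in H, H'; destruct H as [a Ha], H' as [b Hb].
  apply lt_succ_iff; exists (a + b); unfold fr; rewrite Hb, Ha; ring.
Qed.

(** Every code of this integer is [pr (k + j) j] for some [j], which is no smaller. *)
Lemma semZ_nat k : semZ (pr k 0).
Proof.
  exists k, 0; split; trivial; intros i j E; rewrite add_0_r in E; subst i.
  rewrite lt_iff; intros [z Hz]; unfold pr in Hz.
  apply (add_ne_self ((k + 0) * (k + 0) + k) ((1 + 1) * (1 + 1) * (j * j + j * k) + j + z)).
  rewrite Hz at 1; ring.
Qed.

(** Otherwise [pr x 0] would be a smaller code of the same integer. *)
Lemma semZ_nonneg a a' x : semZ (pr a a') -> a = a' + x -> a' = 0.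
Proof.
  intros (i & j & E & H) ->; pr_inj; subst i j.
  destruct (zero_or_succ a') as [|[b ->]]; trivial; exfalso.
  apply (H x 0); [ring|]; apply lt_iff; unfold pr.
  exists (x * (b + 1) * (1 + 1) * (1 + 1) + (b + b + 1 + 1) * (b + b + 1 + 1) + b); ring.
Qed.

Lemma semZpos_nat d : d <> 0 -> semZpos (pr d 0).
Proof.
  intros Hd; split; [apply semZ_nat|]; exists d, 0; split; trivial.
  destruct (zero_or_succ d) as [|[b ->]]; [tauto|]; apply lt_iff; exists b; ring.
Qed.

Lemma semZpos_elim b b' : semZpos (pr b b') -> b' = 0 /\ b <> 0.
Proof.
  intros (HZ & i & j & E & H); pr_inj; subst i j; rewrite !add_0_l in H.
  apply lt_iff in H; destruct H as [z ->].
  split; [|apply succ_ne0]; eapply semZ_nonneg; [exact HZ|symmetry; apply add_assoc].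
Qed.

Lemma semrel_fr (R : M -> M -> Prop) k d k' d' :
  semrel R (fr k d) (fr k' d') <-> R (k * d') (k' * d).
Proof.
  assert (E1 : forall a b c e : M, a * b + 0 * 0 + (c * 0 + 0 * e) = a * b) by (intros; ring).
  assert (E2 : forall a b c e : M, a * 0 + 0 * b + (c * e + 0 * 0) = e * c) by (intros; ring).
  split.
  - intros (a & a' & b & b' & c & c' & e & e' & H1 & H2 & H); unfold fr in *; pr_inj; subst.
    now rewrite E1, E2 in H.
  - intros H; exists k, 0, d, 0, k', 0, d', 0; split; [|split]; trivial; now rewrite E1, E2.
Qed.

Lemma semFrac_fr k d : d <> 0 -> semFrac (fr k d).
Proof.
  intros Hd; exists (pr k 0), (pr d 0); split; [|split]; auto using semZ_nat, semZpos_nat.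
Qed.

Lemma exists_rational k d : d <> 0 ->
  exists k' d', d' <> 0 /\ k' * d = k * d' /\ semQ (fr k' d').
Proof.
  intros Hd.
  (* [X] holds the codes [fr k' d'] of the value [k / d]. Its least element is least among all equal
     fraction codes, because such a fraction has nonnegative numerator and positive denominator,
     which as integers have second component 0, and so lies in [X]. *)
  destruct (bounded_comprehension (ex< #1 + 1, ex< #2 + 1,
    (#3 = ⟨⟨#1, 0⟩, ⟨#0, 0⟩⟩ /\ ~ #0 = 0 /\ #1 * #5 = #4 * #0))%df (env [k; d]) v0) as [X HX].
  change (forall x, x ∈ X <-> exists k', k' < x + 1 /\ exists d', d' < x + 1 /\
    x = fr k' d' /\ d' <> 0 /\ k' * d = k * d') in HX.
  assert (HX' : forall k' d', d' <> 0 -> k' * d = k * d' -> fr k' d' ∈ X).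
  { intros k' d' Hd' E; apply HX.
    exists k'; split; [apply fr_fst_le|]; exists d'; split; [apply fr_snd_le|auto]. }
  destruct (least_element X (fr k d)) as (x & Hx & Hmin); [now apply HX'|].
  apply HX in Hx; destruct Hx as (k' & _ & d' & _ & -> & Hd' & E).
  exists k', d'; split; [|split]; trivial; split; [now apply semFrac_fr|].
  intros y [(s & t & -> & Hs & Ht) Hy]; apply Hmin.
  destruct Hy as (a & a' & b & b' & c & c' & e & e' & H1 & H2 & H).
  unfold fr in H2; pr_inj; subst c c' e e' s t.
  apply semZpos_elim in Ht; destruct Ht as [-> Hb].
  assert (Ha : a * d' = a' * d' + b * k').
  { transitivity (a * d' + a' * 0 + (b * 0 + 0 * k')); [ring|]; rewrite H; ring. }
  assert (a' = 0) as ->.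
  { destruct (le_or_lt a' a) as [[x Hx]|[x ->]].
    - now apply (semZ_nonneg a a' x).
    - exfalso; destruct (zero_or_succ d') as [|[f ->]]; [tauto|].
      apply (add_ne_self (a * (f + 1)) (x * (f + 1) + f + b * k')).
      rewrite Ha at 1; ring. }
  apply HX'; trivial; apply (mul_cancel _ _ d' Hd').
  replace (a * d * d') with (a * d' * d) by ring; rewrite Ha.
  replace ((0 * d' + b * k') * d) with (b * (k' * d)) by ring; rewrite E; ring.
Qed.

(* With [a / b = k / d] and [a2 / b2 = k2 / d2], the inequality [a / b <= a2 / b2]
   implies [k / d <= k2 / d2]. *)
Lemma frac_le_transfer a b a2 b2 k d k2 d2 :
  b <> 0 -> b2 <> 0 -> a * d = k * b -> a2 * d2 = k2 * b2 ->
  (exists z, a2 * b = a * b2 + z) -> exists z, k2 * d = k * d2 + z.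
Proof.
  intros Hb Hb2 E E2 [z Hz]; destruct (le_or_lt (k * d2) (k2 * d)) as [|[w Hw]]; trivial.
  exfalso; destruct (zero_or_succ b) as [|[c ->]]; [tauto|].
  destruct (zero_or_succ b2) as [|[c2 ->]]; [tauto|].
  apply (add_ne_self (a * d * (d2 * (c2 + 1)))
    (z * d * d2 + w * (c + 1) * (c2 + 1) + c * c2 + c + c2)).
  rewrite E at 1.
  replace (k * (c + 1) * (d2 * (c2 + 1))) with (k * d2 * ((c + 1) * (c2 + 1))) by ring.
  rewrite Hw.
  replace ((k2 * d + w + 1) * ((c + 1) * (c2 + 1))) with
    (k2 * (c2 + 1) * d * (c + 1) + (w + 1) * (c + 1) * (c2 + 1)) by ring.
  rewrite <- E2.
  replace (a2 * d2 * d * (c + 1)) with (a2 * (c + 1) * d * d2) by ring; rewrite Hz; ring.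
Qed.

(** * The diagonal initial interval *)

Section Embedding.

Context (P L W F : sets M).
Context (L_field : forall x y, pr x y ∈ L -> x ∈ P /\ y ∈ P).
Context (L_refl : forall x, x ∈ P -> pr x x ∈ L).
Context (L_antisym : forall x y, pr x y ∈ L -> pr y x ∈ L -> x = y).
Context (L_trans : forall x y z, pr x y ∈ L -> pr y z ∈ L -> pr x z ∈ L).
Context (W_enum : forall I, (forall x, x ∈ I -> x ∈ P) ->
  (forall x y, pr x y ∈ L -> y ∈ I -> x ∈ I) -> exists n, forall x, x ∈ I <-> pr n x ∈ W).
Context (F_range : forall q y, pr q y ∈ F -> y ∈ P).
Context (F_total : forall q, semQ q -> exists y, pr q y ∈ F).
Context (F_embed : forall q r x y, pr q x ∈ F -> pr r y ∈ F ->
  (semrel (fun a b => a < b \/ a = b) q r <-> pr x y ∈ L)).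

(* [y] is the image of the rational [k / d], whose least code is [q]. *)
Definition img k d y : Prop :=
  exists q, pr q y ∈ F /\ exists k', k' < q + 1 /\ exists d', d' < q + 1 /\
    q = fr k' d' /\ d' <> 0 /\ k' * d = k * d'.

Lemma img_total k d : d <> 0 -> exists y, img k d y.
Proof.
  intros Hd; destruct (exists_rational k d Hd) as (k' & d' & Hd' & E & HQ).
  destruct (F_total _ HQ) as [y Hy]; exists y, (fr k' d'); split; trivial.
  exists k'; split; [apply fr_fst_le|]; exists d'; split; [apply fr_snd_le|auto].
Qed.

Lemma img_range k d y : img k d y -> y ∈ P.
Proof. intros (q & H & _); eauto. Qed.

(** Cross-multiplied comparison does not depend on the fractions chosen for two rationals, so
    [frac_le_transfer] serves in both directions. *)
Lemma img_le k d y k2 d2 y2 : d <> 0 -> d2 <> 0 -> img k d y -> img k2 d2 y2 ->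
  (pr y y2 ∈ L <-> exists z, k2 * d = k * d2 + z).
Proof.
  intros Hd Hd2 (q & Hq & a & _ & b & _ & -> & Hb & E)
    (q2 & Hq2 & a2 & _ & b2 & _ & -> & Hb2 & E2).
  rewrite <- (F_embed _ _ _ _ Hq Hq2), semrel_fr, <- lt_succ, lt_succ_iff; split.
  - now apply frac_le_transfer.
  - now apply frac_le_transfer.
Qed.

Lemma img_unique k d y y2 : d <> 0 -> img k d y -> img k d y2 -> y = y2.
Proof.
  intros Hd H H2; apply L_antisym.
  - apply (img_le k d y k d y2); trivial; exists 0; ring.
  - apply (img_le k d y2 k d y); trivial; exists 0; ring.
Qed.

Lemma img_set : exists X, forall k d y, pr (pr k d) y ∈ X <-> d <> 0 /\ img k d y.
Proof.
  destruct (Delta_comprehension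
    (ex< #1 + 1, ex< #2 + 1, ex< #3 + 1, (#4 = ⟨⟨#2, #1⟩, #0⟩ /\ ~ #1 = 0 /\
       ex< #3, (⟨#0, #1⟩ ∈ 0 /\ ex< #0 + 1, ex< #1 + 1,
         (#2 = ⟨⟨#1, 0⟩, ⟨#0, 0⟩⟩ /\ ~ #0 = 0 /\ #1 * #4 = #5 * #0))))%df
    (ex< #1 + 1, ex< #2 + 1, ex< #3 + 1, (#4 = ⟨⟨#2, #1⟩, #0⟩ /\ ~ #1 = 0 /\
       all< #3, all< #4, (⟨#1, #0⟩ ∈ 0 /\ (ex< #1 + 1, ex< #2 + 1,
         (#3 = ⟨⟨#1, 0⟩, ⟨#0, 0⟩⟩ /\ ~ #0 = 0 /\ #1 * #5 = #6 * #0)) ⇒ #0 = #2)))%df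
    (env []) (fun _ => F)) as [X HX].
  - change (forall x,
     (exists z k, k < x + 1 /\ exists d, d < x + 1 /\ exists y, y < x + 1 /\
        x = pr (pr k d) y /\ d <> 0 /\ exists q, q < z /\ pr q y ∈ F /\
          exists k', k' < q + 1 /\ exists d', d' < q + 1 /\
            q = fr k' d' /\ d' <> 0 /\ k' * d = k * d') <->
     (forall z, exists k, k < x + 1 /\ exists d, d < x + 1 /\ exists y, y < x + 1 /\
        x = pr (pr k d) y /\ d <> 0 /\ forall q, q < z -> forall y', y' < z ->
          pr q y' ∈ F /\ (exists k', k' < q + 1 /\ exists d', d' < q + 1 /\
            q = fr k' d' /\ d' <> 0 /\ k' * d = k * d') -> y' = y)).
    intros x; split.
    + intros (z & k & Hk & d & Hd & y & Hy & E & Hd0 & q & _ & Hq) z'.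
      exists k; split; trivial; exists d; split; trivial; exists y; split; trivial.
      split; [|split]; trivial; intros q' _ y' _ Hq'.
      apply (img_unique k d); [trivial|now exists q'|now exists q].
    + intros H; destruct (H 0) as (k & Hk & d & Hd & y & Hy & -> & Hd0 & _).
      destruct (img_total k d Hd0) as (y' & q & Hq).
      destruct (bound5 q y' 0 0 0) as (z & Hqz & Hyz & _).
      destruct (H z) as (k1 & _ & d1 & _ & y1 & _ & E & _ & Hu); pr_inj; subst k1 d1 y1.
      assert (y' = y) by (apply (Hu q Hqz y' Hyz Hq)); subst y'.
      exists z, k; split; trivial; exists d; split; trivial; exists y; split; trivial.
      split; [|split]; trivial; now exists q.
  - change (forall x, x ∈ X <->
      exists z k, k < x + 1 /\ exists d, d < x + 1 /\ exists y, y < x + 1 /\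
        x = pr (pr k d) y /\ d <> 0 /\ exists q, q < z /\ pr q y ∈ F /\
          exists k', k' < q + 1 /\ exists d', d' < q + 1 /\
            q = fr k' d' /\ d' <> 0 /\ k' * d = k * d') in HX.
    exists X; intros k d y; rewrite HX; split.
    + intros (z & k1 & _ & d1 & _ & y1 & _ & E & Hd0 & q & _ & Hq); pr_inj; subst k1 d1 y1.
      split; trivial; now exists q.
    + intros [Hd (q & Hq)]; destruct (bound5 q 0 0 0 0) as (z & Hz & _).
      exists z, k; split; [pr_bound|]; exists d; split; [pr_bound|].
      exists y; split; [pr_bound|].
      split; [|split]; trivial; now exists q.
Qed.

(** * The bisecting sequence of intervals *)

Lemma double_ne0 x : x <> 0 -> x + x <> 0.
Proof.
  intros Hx; destruct (zero_or_succ x) as [|[y ->]]; [tauto|].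
  rewrite add_assoc; apply succ_ne0.
Qed.

(* Stage [n] holds the interval [(k / e, (k + 1) / e)]; its lower half is kept if
   the image of the midpoint belongs to the [n]-th initial interval, so that the
   limit cut disagrees with it at the midpoint. *)
Definition next n y k k' : Prop :=
  (pr n y ∈ W /\ k' = k + k) \/ (~ pr n y ∈ W /\ k' = k + k + 1).

Lemma next_total n y k : exists k', next n y k k'.
Proof.
  destruct (classic (pr n y ∈ W)); [exists (k + k); now left|exists (k + k + 1); now right].
Qed.

Lemma next_unique n y k k' k'' : next n y k k' -> next n y k k'' -> k' = k''.
Proof. intros [[? ->]|[? ->]] [[? ->]|[? ->]]; tauto. Qed.

(** The transition table for [recursion]. The midpoint has exactly one image [y], so [y] may be
    quantified either way. The first clause lets a bare element of [T] be taken apart when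
    single-valuedness is checked. *)
Lemma bisection_step : exists T,
  (forall x, x ∈ T -> exists n k e k' e', x = pr n (pr (pr k e) (pr k' e'))) /\
  forall n k e k' e', pr n (pr (pr k e) (pr k' e')) ∈ T <->
    e <> 0 /\ e' = e + e /\ exists y, img (k + k + 1) (e + e) y /\ next n y k k'.
Proof.
  destruct img_set as [X HX].
  destruct (Delta_comprehension
    (ex< #1 + 1, ex< #2 + 1, ex< #3 + 1, ex< #4 + 1, ex< #5 + 1,
      (#6 = ⟨#4, ⟨⟨#3, #2⟩, ⟨#1, #0⟩⟩⟩ /\ ~ #2 = 0 /\ #0 = #2 + #2 /\
       ex< #5, (⟨⟨#4 + #4 + 1, #3 + #3⟩, #0⟩ ∈ 0 /\
         (⟨#5, #0⟩ ∈ 1 /\ #2 = #4 + #4 \/ ~ ⟨#5, #0⟩ ∈ 1 /\ #2 = #4 + #4 + 1))))%df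
    (ex< #1 + 1, ex< #2 + 1, ex< #3 + 1, ex< #4 + 1, ex< #5 + 1,
      (#6 = ⟨#4, ⟨⟨#3, #2⟩, ⟨#1, #0⟩⟩⟩ /\ ~ #2 = 0 /\ #0 = #2 + #2 /\
       all< #5, (⟨⟨#4 + #4 + 1, #3 + #3⟩, #0⟩ ∈ 0 ⇒
         (⟨#5, #0⟩ ∈ 1 /\ #2 = #4 + #4 \/ ~ ⟨#5, #0⟩ ∈ 1 /\ #2 = #4 + #4 + 1))))%df
    (env []) (fun i : nat => match i with O => X | _ => W end)) as [T HT].
  - change (forall x,
     (exists z n, n < x + 1 /\ exists k, k < x + 1 /\ exists e, e < x + 1 /\
        exists k', k' < x + 1 /\ exists e', e' < x + 1 /\
        x = pr n (pr (pr k e) (pr k' e')) /\ e <> 0 /\ e' = e + e /\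
        exists y, y < z /\ pr (pr (k + k + 1) (e + e)) y ∈ X /\ next n y k k') <->
     (forall z, exists n, n < x + 1 /\ exists k, k < x + 1 /\ exists e, e < x + 1 /\
        exists k', k' < x + 1 /\ exists e', e' < x + 1 /\
        x = pr n (pr (pr k e) (pr k' e')) /\ e <> 0 /\ e' = e + e /\
        forall y, y < z -> pr (pr (k + k + 1) (e + e)) y ∈ X -> next n y k k')).
    intros x; split.
    + intros (z & n & Hn & k & Hk & e & He & k' & Hk' & e' & He' & E & He0 & E' & y & _ & Hy & Hb) z'.
      exists n; split; trivial; exists k; split; trivial; exists e; split; trivial.
      exists k'; split; trivial; exists e'; split; trivial; split; [|split; [|split]]; trivial.
      intros y' _ Hy'; apply HX in Hy, Hy'; destruct Hy as [Hee Hy], Hy' as [_ Hy'].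
      now rewrite (img_unique _ _ _ _ Hee Hy' Hy).
    + intros H.
      destruct (H 0) as (n & Hn & k & Hk & e & He & k' & Hk' & e' & He' & -> & He0 & -> & _).
      destruct (img_total (k + k + 1) (e + e) (double_ne0 e He0)) as (y & Hy).
      destruct (bound5 y 0 0 0 0) as (z & Hz & _).
      destruct (H z) as (n1 & _ & k1 & _ & e1 & _ & k2 & _ & e2 & _ & E & _ & _ & Hu).
      pr_inj; subst n1 k1 e1 k2 e2.
      exists z, n; split; trivial; exists k; split; trivial; exists e; split; trivial.
      exists k'; split; trivial; exists (e + e); split; trivial; split; [|split; [|split]]; trivial.
      exists y; split; [|split]; trivial.
      * apply HX; auto using double_ne0.
      * apply Hu; trivial; apply HX; auto using double_ne0.
  - change (forall x, x ∈ T <->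
      exists z n, n < x + 1 /\ exists k, k < x + 1 /\ exists e, e < x + 1 /\
        exists k', k' < x + 1 /\ exists e', e' < x + 1 /\
        x = pr n (pr (pr k e) (pr k' e')) /\ e <> 0 /\ e' = e + e /\
        exists y, y < z /\ pr (pr (k + k + 1) (e + e)) y ∈ X /\ next n y k k') in HT.
    exists T; split.
    { intros x Hx; apply HT in Hx.
      destruct Hx as (_ & n & _ & k & _ & e & _ & k' & _ & e' & _ & E & _).
      exists n, k, e, k', e'; exact E. }
    intros n k e k' e'; rewrite HT; split.
    + intros (z & n1 & _ & k1 & _ & e1 & _ & k2 & _ & e2 & _ & E & He & E' & y & _ & Hy & Hb).
      pr_inj; subst n1 k1 e1 k2 e2; split; [|split]; trivial.
      apply HX in Hy; exists y; tauto.
    + intros (He & -> & y & Hy & Hb); destruct (bound5 y 0 0 0 0) as (z & Hz & _).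
      exists z, n; split; [pr_bound|]; exists k; split; [pr_bound|].
      exists e; split; [pr_bound|]; exists k'; split; [pr_bound|].
      exists (e + e); split; [pr_bound|]; split; [|split; [|split]]; trivial.
      exists y; split; [|split]; trivial; apply HX; auto using double_ne0.
Qed.

Lemma one_ne0 : (1 : M) <> 0.
Proof. rewrite <- (add_0_l 1); apply succ_ne0. Qed.

(** The last clause takes the midpoint's image [y] as given: [y] is fixed first, and then it is
    learnt which half was kept. *)
Definition bisection G : Prop :=
  (forall n k e k' e', pr n (pr k e) ∈ G -> pr n (pr k' e') ∈ G -> k = k' /\ e = e') /\
  (forall n, exists k e, e <> 0 /\ pr n (pr k e) ∈ G) /\
  (forall n k e y, e <> 0 -> pr n (pr k e) ∈ G -> img (k + k + 1) (e + e) y ->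
     exists k', next n y k k' /\ pr (n + 1) (pr k' (e + e)) ∈ G).

Lemma exists_bisection : exists G, bisection G.
Proof.
  destruct bisection_step as (T & HT & HT').
  destruct (bounded_comprehension (ex< #1 + 1, ex< #2 + 1, (#3 = ⟨#1, #0⟩ /\ ~ #0 = 0))%df
    (env []) v0) as [V HV].
  change (forall v, v ∈ V <-> exists k, k < v + 1 /\ exists e, e < v + 1 /\
    v = pr k e /\ e <> 0) in HV.
  assert (HV' : forall k e, e <> 0 -> pr k e ∈ V).
  { intros k e He; apply HV; exists k; split; [pr_bound|]; exists e; split; [pr_bound|auto]. }
  destruct (recursion T V (pr 0 1)) as (G & G_fun & _ & G_total & G_step).
  - intros n u w w' Hw Hw'; pose proof Hw as Hx; pose proof Hw' as Hx'.
    apply HT in Hx, Hx'.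
    destruct Hx as (n1 & k & e & k' & e' & E), Hx' as (n2 & k2 & e2 & k2' & e2' & E2).
    pr_inj; subst; pr_inj; subst.
    apply HT' in Hw, Hw'; destruct Hw as (He & -> & y & Hy & Hn), Hw' as (_ & -> & y' & Hy' & Hn').
    rewrite (img_unique _ _ _ _ (double_ne0 _ He) Hy' Hy) in Hn'.
    now rewrite (next_unique _ _ _ _ _ Hn Hn').
  - apply HV', one_ne0.
  - intros n v Hv; apply HV in Hv; destruct Hv as (k & _ & e & _ & -> & He).
    destruct (img_total (k + k + 1) (e + e) (double_ne0 e He)) as [y Hy].
    destruct (next_total n y k) as [k' Hk'].
    exists (pr k' (e + e)); split; [now apply HV', double_ne0|apply HT']; eauto.
  - exists G; split; [|split].
    + intros n k e k' e' H H'; pose proof (G_fun _ _ _ H H'); now apply pr_inj.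
    + intros n; destruct (G_total n) as (v & Hv & Hn); apply HV in Hv.
      destruct Hv as (k & _ & e & _ & -> & He); eauto.
    + intros n k e y He Hn Hy; destruct (next_total n y k) as [k' Hk'].
      exists k'; split; trivial; apply (G_step _ _ _ Hn), HT'; eauto.
Qed.

(** The terms [a] and [b] are the cross-multiplied gaps at the left and right ends. Each halving
    doubles both and adds [e] to the gap at the end that moved. *)
Lemma bisection_nested G : bisection G -> forall i k e, e <> 0 -> pr i (pr k e) ∈ G ->
  forall d, exists k' e', pr (i + d) (pr k' e') ∈ G /\ e' <> 0 /\
    (exists a, k' * e = k * e' + a) /\ (exists b, (k + 1) * e' = (k' + 1) * e + b).
Proof.
  intros (_ & _ & G_step) i k e He Hi.
  assert (H : forall d, exists z k', k' < z /\ exists e', e' < z /\ exists a, a < z /\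
    exists b, b < z /\ pr (i + d) (pr k' e') ∈ G /\ e' <> 0 /\
      k' * e = k * e' + a /\ (k + 1) * e' = (k' + 1) * e + b).
  { refine (Sigma_induction (ex< #0, ex< #1, ex< #2, ex< #3,
      (⟨#6 + #5, ⟨#3, #2⟩⟩ ∈ 0 /\ ~ #2 = 0 /\ #3 * #8 = #7 * #2 + #1 /\
       (#7 + 1) * #2 = (#3 + 1) * #8 + #0))%df (env [i; k; e]) (fun _ => G) _ _); cbn.
    - destruct (bound5 k e 0 0 0) as (z & Hk & Hez & H0 & _).
      exists z, k; split; trivial; exists e; split; trivial; exists 0; split; trivial.
      exists 0; split; trivial; rewrite !add_0_r; auto.
    - intros d (_ & k' & _ & e' & _ & a & _ & b & _ & Hd & He' & Ha & Hb).
      destruct (img_total (k' + k' + 1) (e' + e') (double_ne0 e' He')) as [y Hy].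
      destruct (G_step _ _ _ _ He' Hd Hy) as (k2 & Hk2 & Hd2); rewrite <- add_assoc in Hd2.
      assert (E : (k + 1) * (e' + e') = (k' + 1) * e + b + ((k' + 1) * e + b))
        by (rewrite <- Hb; ring).
      destruct Hk2 as [[_ ->]|[_ ->]].
      + destruct (bound5 (k' + k') (e' + e') (a + a) (e + b + b) 0) as (z & ? & ? & ? & ? & _).
        exists z, (k' + k'); split; trivial; exists (e' + e'); split; trivial.
        exists (a + a); split; trivial; exists (e + b + b); split; trivial.
        split; [|split; [|split]]; auto using double_ne0.
        * transitivity (k' * e + k' * e); [ring|rewrite Ha; ring].
        * rewrite E; ring.
      + destruct (bound5 (k' + k' + 1) (e' + e') (a + a + e) (b + b) 0) as (z & ? & ? & ? & ? & _).
        exists z, (k' + k' + 1); split; trivial; exists (e' + e'); split; trivial.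
        exists (a + a + e); split; trivial; exists (b + b); split; trivial.
        split; [|split; [|split]]; auto using double_ne0.
        * transitivity (k' * e + k' * e + e); [ring|rewrite Ha; ring].
        * rewrite E; ring. }
  intros d; destruct (H d) as (_ & k' & _ & e' & _ & a & _ & b & _ & Hd & He' & Ha & Hb).
  exists k', e'; split; [|split; [|split]]; eauto.
Qed.

(** Of two stages, the later interval lies inside the earlier one, and each interval has its left
    end strictly below its right end. *)
Lemma bisection_lt G : bisection G -> forall i k e j k' e', e <> 0 -> e' <> 0 ->
  pr i (pr k e) ∈ G -> pr j (pr k' e') ∈ G -> exists z, (k + 1) * e' = k' * e + z + 1.
Proof.
  intros HG i k e j k' e' He He' Hi Hj; destruct (le_or_lt i j) as [[w ->]|[w ->]].
  - destruct (bisection_nested G HG i k e He Hi w) as (k2 & e2 & Hw & _ & _ & b & Hb).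
    destruct (proj1 HG _ _ _ _ _ Hj Hw) as [<- <-].
    destruct (zero_or_succ e) as [|[f ->]]; [tauto|].
    exists (f + b); rewrite Hb; ring.
  - destruct (bisection_nested G HG j k' e' He' Hj (w + 1)) as (k2 & e2 & Hw & _ & [a Ha] & _).
    rewrite add_assoc in Hw; destruct (proj1 HG _ _ _ _ _ Hi Hw) as [<- <-].
    destruct (zero_or_succ e') as [|[f ->]]; [tauto|].
    exists (a + f); transitivity (k * (f + 1) + f + 1); [ring|rewrite Ha; ring].
Qed.

Lemma no_embedding : False.
Proof.
  destruct exists_bisection as [G HG]; pose proof HG as (_ & G_total & G_step).
  destruct img_set as [X HX].
  (* Sigma form: below the image of some left endpoint [k / e]. Pi form: below the images of all
     right endpoints [(k + 1) / e]. *)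
  destruct (Delta_comprehension
    (ex< #0, ex< #1, ex< #2, ex< #3,
      (⟨#3, ⟨#2, #1⟩⟩ ∈ 0 /\ ⟨⟨#2, #1⟩, #0⟩ ∈ 1 /\ ⟨#5, #0⟩ ∈ 2))%df
    (all< #0, all< #1, all< #2, all< #3,
      (⟨#3, ⟨#2, #1⟩⟩ ∈ 0 ⇒ ⟨⟨#2 + 1, #1⟩, #0⟩ ∈ 1 ⇒ ⟨#5, #0⟩ ∈ 2))%df
    (env []) (fun i : nat => match i with O => G | S O => X | _ => L end)) as [I HI].
  { change (forall x,
      (exists z n, n < z /\ exists k, k < z /\ exists e, e < z /\ exists y, y < z /\
         pr n (pr k e) ∈ G /\ pr (pr k e) y ∈ X /\ pr x y ∈ L) <->
      (forall z n, n < z -> forall k, k < z -> forall e, e < z -> forall y, y < z ->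
         pr n (pr k e) ∈ G -> pr (pr (k + 1) e) y ∈ X -> pr x y ∈ L)).
    intros x; split.
    - intros (_ & n & _ & k & _ & e & _ & y & _ & Hn & Hy & Hx) _ m _ k' _ e' _ y' _ Hm Hy'.
      apply HX in Hy, Hy'; destruct Hy as [He Hy], Hy' as [He' Hy'].
      apply L_trans with y; trivial; apply (img_le k e y (k' + 1) e' y'); trivial.
      destruct (bisection_lt G HG m k' e' n k e) as [z Hz]; trivial.
      exists (z + 1); rewrite Hz; ring.
    - (* [x] is decided at the stage that treats [{z | not x <= z}]. *)
      intros H.
      destruct (bounded_comprehension (#1 ∈ 0 /\ ~ ⟨#2, #1⟩ ∈ 1)%df (env [x])
        (fun i : nat => match i with O => P | _ => L end)) as [U HU].
      change (forall z, z ∈ U <-> z ∈ P /\ ~ pr x z ∈ L) in HU.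
      destruct (W_enum U) as [n Hn].
      { intros z Hz; now apply HU in Hz. }
      { intros y z Hyz Hz; apply HU in Hz; apply HU; split; [now apply L_field in Hyz|].
        intros Hxy; apply Hz; now apply L_trans with y. }
      destruct (G_total n) as (k & e & He & Hk).
      destruct (img_total (k + k + 1) (e + e) (double_ne0 e He)) as [y Hy].
      destruct (G_step n k e y He Hk Hy) as (k' & [[Hw ->]|[Hw ->]] & Hk').
      (* Lower half kept: the midpoint is the right endpoint of the next stage, so [H] puts [x]
         below its image [y], while [y] in [U] denies it. *)
      + exfalso; apply Hn, HU in Hw; apply (proj2 Hw).
        destruct (bound5 (n + 1) (k + k) (e + e) y 0) as (z & ? & ? & ? & ? & _).
        apply (H z (n + 1)) with (k + k) (e + e); trivial; apply HX; auto using double_ne0.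
      (* Upper half kept: the midpoint is the next left endpoint, and [y] outside [U] means that [x]
         is below [y]. *)
      + destruct (bound5 (n + 1) (k + k + 1) (e + e) y 0) as (z & ? & ? & ? & ? & _).
        exists z, (n + 1); split; trivial; exists (k + k + 1); split; trivial.
        exists (e + e); split; trivial; exists y; split; trivial; split; [|split]; trivial.
        * apply HX; auto using double_ne0.
        * apply NNPP; intros Hx; apply Hw, Hn, HU; eauto using img_range. }
  change (forall x, x ∈ I <->
    exists z n, n < z /\ exists k, k < z /\ exists e, e < z /\ exists y, y < z /\
      pr n (pr k e) ∈ G /\ pr (pr k e) y ∈ X /\ pr x y ∈ L) in HI.
  assert (HI' : forall x, x ∈ I <-> exists n k e y,
    pr n (pr k e) ∈ G /\ e <> 0 /\ img k e y /\ pr x y ∈ L).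
  { intros x; rewrite HI; split.
    - intros (_ & n & _ & k & _ & e & _ & y & _ & Hn & Hy & Hx); apply HX in Hy.
      exists n, k, e, y; tauto.
    - intros (n & k & e & y & Hn & He & Hy & Hx).
      destruct (bound5 n k e y 0) as (z & ? & ? & ? & ? & _).
      exists z, n; split; trivial; exists k; split; trivial; exists e; split; trivial.
      exists y; split; [|split; [|split]]; trivial; now apply HX. }
  destruct (W_enum I) as [n Hn].
  - intros x Hx; apply HI' in Hx; destruct Hx as (_ & _ & _ & y & _ & _ & _ & Hx).
    now apply L_field in Hx.
  - intros x y Hxy Hy; apply HI' in Hy; destruct Hy as (n & k & e & z & Hn & He & Hz & Hy).
    apply HI'; exists n, k, e, z; split; [|split; [|split]]; trivial; now apply L_trans with y.
  - destruct (G_total n) as (k & e & He & Hk).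
    destruct (img_total (k + k + 1) (e + e) (double_ne0 e He)) as [y Hy].
    destruct (G_step n k e y He Hk Hy) as (k' & [[Hw ->]|[Hw ->]] & Hk').
    (* Lower half kept: the midpoint is a right endpoint, strictly above every left endpoint, so [y]
       cannot be in [I]. *)
    + apply Hn, HI' in Hw; destruct Hw as (j & k2 & e2 & y2 & Hj & He2 & Hy2 & Hle).
      apply (img_le (k + k + 1) (e + e) y k2 e2 y2) in Hle; auto using double_ne0.
      destruct Hle as [a Ha].
      destruct (bisection_lt G HG (n + 1) (k + k) (e + e) j k2 e2) as [z Hz];
        auto using double_ne0.
      apply (add_ne_self (k2 * (e + e)) (a + z)); rewrite Ha at 1; rewrite Hz; ring.
    (* Upper half kept: the midpoint is a left endpoint, so reflexivity puts [y] in [I]. *)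
    + apply Hw, Hn, HI'; exists (n + 1), (k + k + 1), (e + e), y.
      split; [|split; [|split]]; auto using double_ne0; apply L_refl; eauto using img_range.
Qed.

End Embedding.

End Model.

Theorem theorem5p2 :
  RCA0 ⊢ AllSet (AllSet (partial_order 1 0
             ⇒ countably_many_initial_intervals 1 0
             ⇒ scattered 1 0)).
Proof.
  apply completeness; [intros; now apply RCA0_closed|].
  (* The outer set quantifier ends up at index 1, so the carrier [P] comes first. As [scattered] is
     a negation, [HS] asserts an embedding and the goal becomes falsity. *)
  intros M e v HM P L HPO HC HS.
  unfold countably_many_initial_intervals in HC.
  apply sat_ExSet in HS; destruct HS as [F HF].
  apply sat_ExSet in HC; destruct HC as [W HC].
  apply sat_And in HPO; destruct HPO as [L_field HPO].
  apply sat_And in HPO; destruct HPO as [L_refl HPO].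
  apply sat_And in HPO; destruct HPO as [L_antisym L_trans].
  apply sat_And in HF; destruct HF as [HF F_embed].
  apply sat_And in HF; destruct HF as [F_range HF].
  apply sat_And in HF; destruct HF as [F_total _].
  apply (no_embedding M e v HM P L W F).
  - intros x y Hxy; specialize (L_field _ Hxy).
    apply sat_ExNum in L_field; destruct L_field as [x' H].
    apply sat_ExNum in H; destruct H as [y' H].
    apply sat_And in H; destruct H as [E H]; apply sat_And in H.
    change (pr x y = pr x' y') in E; apply (pr_inj M e v HM) in E; destruct E; subst x' y'.
    exact H.
  - exact L_refl.
  - exact L_antisym.
  - exact L_trans.
  - intros I H1 H2; specialize (HC I); cbn [sat] in HC; rewrite sat_ExNum in HC.
    destruct HC as [n Hn].
    + apply sat_And; split; [exact H1|exact H2].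
    + exists n; intros x; specialize (Hn x); rewrite sat_Iff in Hn; exact Hn.
  - intros q y Hq; specialize (F_range _ Hq).
    apply sat_ExNum in F_range; destruct F_range as [q' H].
    apply sat_ExNum in H; destruct H as [y' H].
    apply sat_And in H; destruct H as [E H]; apply sat_And in H.
    change (pr q y = pr q' y') in E; apply (pr_inj M e v HM) in E; destruct E; subst q' y'.
    exact (proj2 H).
  - intros q Hq; specialize (F_total q); cbn [sat] in F_total.
    rewrite sat_isQ, sat_ExNum in F_total; now apply F_total.
  - intros q r x y Hq Hr; specialize (F_embed q r x y Hq Hr).
    rewrite sat_Iff, sat_qle in F_embed; exact F_embed.
Qed.
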